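(* Suppose SJA for $m$ items is well-defined. If for every $J\subseteq[m]$ with $U_J\neq\emptyset$ the SIM-body $\Lambda(\lambda_1,\dots,\lambda_{|J|})$ contains no body of positive $1$-deficiency, then SJA is optimal: its expected revenue equals the supremum of expected revenue over all (possibly randomized) IC and IR mechanisms for a single additive buyer with i.i.d. uniform $[0,1]$ values for the $m$ items.
   Context: Mechanisms: allocation $\mathbf a:[0,1]^m\to[0,1]^m$ and payment $p:[0,1]^m\to\mathbb R$; buyer utility for report $\mathbf x'$ and true values $\mathbf x$ is $\mathbf a(\mathbf x')\cdot\mathbf x-p(\mathbf x')$; IC means truthful reporting maximizes utility, IR means truthful utility $\ge 0$; revenue is $\mathbb E[p(\mathbf x)]$. SJA: let $k=1/(m+1)$, $p_0=0$. SJA is the deterministic mechanism selling any bundle of $r$ items at price $p_r$, the buyer taking a bundle maximizing $\sum_{j\in J}x_j-p_{|J|}$. Prices are fixed successively: having fixed $p_1,\dots,p_{r-1}$, $p_r$ is chosen as large as possible with $\Pr_{\mathbf x\sim U[0,1]^r}[\sum_{j\in J}x_j<p_{|J|}\ \forall J\subseteq[r]]=1-rk$; SJA is well-defined if such prices exist. Normalize: for every $j\in[m-1]$ with $p_j\ge p_m$ replace $p_j$ by $p_m$. With normalized prices, $\mu_0=0$, $\mu_r=(m+1)(r-p_r)$, $\lambda_r=\mu_r-\mu_{r-1}$. $U_J=\{\mathbf x\in[0,1]^m:\sum_{j\in J}x_j-p_{|J|}\ge\sum_{j\in L}x_j-p_{|L|}\ \forall L\subseteq[m]\}$. SIM-body: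 for $0<\alpha_1\le\dots\le\alpha_r$, $\Lambda(\alpha_1,\dots,\alpha_r)=\{\mathbf x\in\mathbb R_+^r:\sum_{j\in J}x_j\le\sum_{j=r-|J|+1}^r\alpha_j\ \forall J\subseteq[r]\}$. A body is a compact subset of $\mathbb R_+^r$; its $k$-deficiency is $\delta_k(A)=|A|-k\sum_{j=1}^r|A_{[r]\setminus\{j\}}|$, with $A_{[r]\setminus\{j\}}=\{\mathbf x_{-j}:\mathbf x\in A\}$ and $|\cdot|$ Lebesgue measure in the relevant dimension. *)

(* Defs.v *)
From HB Require Import structures.
From mathcomp Require Import all_boot all_order all_algebra.
From mathcomp Require Import all_classical all_reals all_analysis.

Unset Printing Implicit Defensive.

Import Order.TTheory GRing.Theory Num.Theory.
Import numFieldNormedType.Exports.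

Local Open Scope classical_set_scope.
Local Open Scope ring_scope.

Section Defs.
Variable R : realType.

Definition vcons {n} (t : R) (y : 'rV[R]_n) : 'rV[R]_n.+1 :=
  \row_(i < n.+1) match unlift ord0 i with None => t | Some j => y ord0 j end.

Fixpoint iint {n : nat} : ('rV[R]_n -> \bar R) -> \bar R :=
  match n return ('rV[R]_n -> \bar R) -> \bar R with
  | 0 => fun f => f 0
  | n'.+1 => fun f =>
      (\int[@lebesgue_measure R]_t iint (fun y => f (vcons t y)))%E
  end.

(* n-dimensional Lebesgue measure of A (by Tonelli, for measurable A) *)
Definition vol {n} (A : set 'rV[R]_n) : \bar R := iint (fun x => (\1_A x)%:E).

Definition cube n : set 'rV[R]_n := [set x : 'rV[R]_n | forall i, 0 <= x ord0 i <= 1].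


Definition sja_prob (r : nat) (q : nat -> R) : \bar R :=
  vol (cube r `&` [set x : 'rV[R]_r | forall J : {set 'I_r},
         (0 < #|J|)%N -> \sum_(j in J) x ord0 j < q #|J|]).



Definition upd (q : nat -> R) (r : nat) (t : R) : nat -> R :=
  fun i => if i == r then t else q i.

Definition sja_prices (m : nat) (P : nat -> R) : Prop :=
  P 0%N = 0 /\
  forall r : nat, (1 <= r <= m)%N ->
    sja_prob r P = (1 - r%:R / (m%:R + 1))%:E /\
    (forall t : R, sja_prob r (upd P r t) = (1 - r%:R / (m%:R + 1))%:E ->
       t <= P r).

Definition sja_well_defined (m : nat) : Prop := exists P, sja_prices m P.

Definition norm_price (m : nat) (P : nat -> R) (j : nat) : R :=
  if (1 <= j < m)%N && (P m <= P j) then P m else P j.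

Definition mu (m : nat) (P : nat -> R) (r : nat) : R :=
  if r is 0%N then 0 else (m%:R + 1) * (r%:R - norm_price m P r).

Definition lambda (m : nat) (P : nat -> R) (r : nat) : R :=
  mu m P r - mu m P r.-1.

Definition U_set (m : nat) (P : nat -> R) (J : {set 'I_m}) : set 'rV[R]_m :=
  [set x : 'rV[R]_m | cube m x /\ forall L : {set 'I_m},
     \sum_(j in L) x ord0 j - norm_price m P #|L|
       <= \sum_(j in J) x ord0 j - norm_price m P #|J| ].

(* Lambda(alpha_1, ..., alpha_r), alpha indexed from 1 *)
Definition SIM_body (r : nat) (alpha : nat -> R) : set 'rV[R]_r :=
  [set x : 'rV[R]_r | (forall i, 0 <= x ord0 i) /\ forall J : {set 'I_r},
     \sum_(j in J) x ord0 j <= \sum_((r - #|J|).+1 <= j < r.+1) alpha j].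

Definition body {r : nat} (A : set 'rV[R]_r) : Prop :=
  compact A /\ (forall x, A x -> forall i, 0 <= x ord0 i).

Definition proj_out {r : nat} (j : 'I_r) (A : set 'rV[R]_r) : set 'rV[R]_r.-1 :=
  [set col' j x | x in A].

Definition deficiency (k : R) {r : nat} (A : set 'rV[R]_r) : \bar R :=
  (vol A - k%:E * \sum_(j < r) vol (proj_out j A))%E.

Record mechanism (m : nat) := Mechanism {
  alloc : 'rV[R]_m -> 'rV[R]_m;
  pay : 'rV[R]_m -> R }.
Arguments alloc {m}.
Arguments pay {m}.
Arguments Mechanism {m}.

Definition utility {m} (M : mechanism m) (x' x : 'rV[R]_m) : R :=
  \sum_(i < m) alloc M x' ord0 i * x ord0 i - pay M x'.

Definition feasible {m} (M : mechanism m) : Prop :=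
  forall x, cube m x -> cube m (alloc M x).

Definition IC {m} (M : mechanism m) : Prop :=
  forall x x', cube m x -> cube m x' -> utility M x' x <= utility M x x.

Definition IR {m} (M : mechanism m) : Prop :=
  forall x, cube m x -> 0 <= utility M x x.

Definition revenue {m} (M : mechanism m) : \bar R :=
  iint (fun x => (\1_(cube m) x * pay M x)%:E).

Definition opt_revenue (m : nat) : \bar R :=
  ereal_sup [set revenue M | M in [set M : mechanism m | feasible M /\ IC M /\ IR M]].

(* the SJA mechanism with price vector P (ties broken by a fixed arg max) *)
Definition sja_bundle (m : nat) (P : nat -> R) (x : 'rV[R]_m) : {set 'I_m} :=
  Order.arg_max (finset.set0 : {set 'I_m}) (fun _ => true)
    (fun J : {set 'I_m} => \sum_(j in J) x ord0 j - P #|J|).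

Definition sja_mech (m : nat) (P : nat -> R) : mechanism m :=
  Mechanism (fun x => \row_(i < m) (i \in sja_bundle m P x)%:R)
            (fun x => P #|sja_bundle m P x|).

End Defs.


Arguments vcons {R n}.
Arguments iint {R n}.
Arguments vol {R n}.
Arguments cube {R}.
Arguments sja_prob {R}.
Arguments upd {R}.
Arguments sja_prices {R}.
Arguments norm_price {R}.
Arguments mu {R}.
Arguments lambda {R}.
Arguments U_set {R}.
Arguments SIM_body {R}.
Arguments body {R r}.
Arguments proj_out {R r}.
Arguments deficiency {R} k {r}.
Arguments utility {R m}.
Arguments feasible {R m}.
Arguments IC {R m}.
Arguments IR {R m}.
Arguments revenue {R m}.
Arguments sja_bundle {R}.
Arguments sja_mech {R}.
Arguments alloc {R m}.
Arguments pay {R m}.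
Arguments Mechanism {R m}.

(* Main.v *)
(* The revenue of a mechanism depends only on its indirect utility u and,
   after integrating by parts, equals
     Phi(u) = sum_j int_{x_j = 1} u  -  (m+1) int u,
   a linear functional. Hence SJA, with utility v, has to be compared with u
   through Phi(u - v). On the region U_J the function g = u - v is
   nonincreasing in the coordinates of J, so every sublevel set {g <= t} of a
   slice of U_J is, up to reflection and dilation by m+1, a body inside the
   SIM-body Lambda(lambda_1, .., lambda_|J|), whose face x_j = 1 is its
   projection along j. Nonpositive deficiency then bounds the volume of
   {g <= t} in the union W of the U_J, J nonempty, by 1/(m+1) times the total
   area of {g <= t} on the faces x_j = 1. Outside W we have v = 0, so g >= 0,
   and the choice of p_m gives |W| = m/(m+1). Integrating over t yields
   Phi(u) <= Phi(v). *)
Require Import Defs.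
From HB Require Import structures.
From mathcomp Require Import all_boot all_order all_algebra.
From mathcomp Require Import all_classical all_reals all_analysis.
From mathcomp Require Import measurable_realfun ring lra.
Import Order.TTheory GRing.Theory Num.Theory.
Import numFieldNormedType.Exports.
Local Open Scope classical_set_scope.
Local Open Scope ring_scope.

Set Implicit Arguments.
Unset Strict Implicit.


(** Four choices carry the argument. Payments are arbitrary functions and the indirect utility is
    only Lipschitz, so no derivative is taken: integration by parts is replaced by the change of
    variable x_j := s * x_j, with s tending to 1 from above for the upper bound on revenue and from
    below for the lower one. The dilation factor m+1 raises volume by one more power than the area
    of a projection; this turns the weight 1/(m+1) of the faces into the constant 1 of the
    deficiency. Since g may be negative inside W, a constant G is added before its sublevel sets are
    used; as |W| = m/(m+1), this adds m * G to both sides of the comparison. Finally the regions U_J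
    overlap. In the cube this is harmless, because there only the covering of W matters, but on a
    face x_j = 1 their areas must not exceed that of the union: there two distinct regions whose
    bundles contain j meet inside a hyperplane, which is null. *)

(** * Measurability of functions of a row vector *)

Section RowMeasurability.
Variable R : realType.

Definition mrow {n d} {S : measurableType d} (x : S -> 'rV[R]_n) :=
  forall i, measurable_fun setT (fun s => x s ord0 i).

(* Measurability on R^n for the product sigma-algebra, tested against all
   coordinatewise measurable parametrisations. *)
Definition rmeas {n d'} {T : measurableType d'} (f : 'rV[R]_n -> T) :=
  forall d (S : measurableType d) (x : S -> 'rV[R]_n),
    mrow x -> measurable_fun setT (fun s => f (x s)).

(** Joint measurability in a parameter and a row: Tonelli needs it jointly, and fixing the parameter
    gives back [rmeas]. *)
Definition jmeas {n d d'} {S : measurableType d} {T : measurableType d'}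
    (F : S -> 'rV[R]_n -> T) :=
  forall d2 (S2 : measurableType d2) (p : S2 -> S) (x : S2 -> 'rV[R]_n),
    measurable_fun setT p -> mrow x -> measurable_fun setT (fun s => F (p s) (x s)).

Definition ins {n} (j : 'I_n.+1) (t : R) (y : 'rV[R]_n) : 'rV[R]_n.+1 :=
  \row_i match unlift j i with None => t | Some k => y ord0 k end.

Lemma vconsE n : @vcons R n = ins ord0. Proof. by []. Qed.

Lemma ins_at n (j : 'I_n.+1) t y : ins j t y ord0 j = t.
Proof. by rewrite mxE unlift_none. Qed.

Lemma ins_lift n (j : 'I_n.+1) t y k : ins j t y ord0 (lift j k) = y ord0 k.
Proof. by rewrite mxE liftK. Qed.

Lemma mrow_ins n (j : 'I_n.+1) d (S : measurableType d) (t : S -> R)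
    (y : S -> 'rV[R]_n) :
  measurable_fun setT t -> mrow y -> mrow (fun s => ins j (t s) (y s)).
Proof.
move=> mt my i; case: (unliftP j i) => [k ->|->].
  by under eq_fun do rewrite ins_lift; exact: my.
by under eq_fun do rewrite ins_at.
Qed.

Lemma jmeas_ins n (j : 'I_n.+1) d' (T : measurableType d')
    (f : 'rV[R]_n.+1 -> T) : rmeas f -> jmeas (fun t y => f (ins j t y)).
Proof. by move=> mf d2 S2 p x mp mx; apply: mf; exact: mrow_ins. Qed.

Lemma jmeas_rmeas n d' (T : measurableType d') d (S : measurableType d)
    (F : S -> 'rV[R]_n -> T) s : jmeas F -> rmeas (F s).
Proof. by move=> mF d2 S2 x mx; apply: (mF _ _ (cst s)). Qed.

Lemma rmeas_ins n (j : 'I_n.+1) d' (T : measurableType d')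
    (f : 'rV[R]_n.+1 -> T) t : rmeas f -> rmeas (fun y => f (ins j t y)).
Proof. by move=> mf; apply: (@jmeas_rmeas _ _ _ _ _ (fun t y => f (ins j t y))); exact: jmeas_ins. Qed.

End RowMeasurability.
Arguments ins {R n} j t y.

(** * The iterated integral: monotonicity, Tonelli, reindexing, splitting *)

Section IteratedIntegral.
Variable R : realType.
Implicit Types n : nat.
Local Notation leb := (@lebesgue_measure R).

Import HBNNSimple.

(* Neither function needs to be measurable: the integral of a nonnegative
   function is a supremum over smaller simple functions. *)
Lemma integral_le_unconditional (f g : R -> \bar R) :
  (forall x, (f x <= g x)%E) -> (\int[leb]_x f x <= \int[leb]_x g x)%E.
Proof.
move=> fg; rewrite /integral; apply: leeB.
- apply: le_ereal_sup => _ [h /= hf <-]; exists h => //= x.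
  apply: (le_trans (hf x)); rewrite !patch_setT.
  by rewrite !funeposE ge_max !le_max fg lexx orbT.
- apply: le_ereal_sup => _ [h /= hf <-]; exists h => //= x.
  apply: (le_trans (hf x)); rewrite !patch_setT.
  by rewrite !funenegE ge_max !le_max leeN2 fg lexx orbT.
Qed.

Lemma iint_le n (f g : 'rV[R]_n -> \bar R) :
  (forall x, (f x <= g x)%E) -> (iint f <= iint g)%E.
Proof.
elim: n f g => [|n IH] f g fg /=; first exact: fg.
by apply: integral_le_unconditional => t; apply: IH.
Qed.

Lemma eq_iint n (f g : 'rV[R]_n -> \bar R) : f =1 g -> iint f = iint g.
Proof. by move=> /funext ->. Qed.

Lemma iint0 n : iint (fun _ : 'rV[R]_n => 0%E) = 0%E.
Proof.
elim: n => //= n IH; under eq_integral do rewrite IH.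
exact: integral0.
Qed.

Lemma iint_ge0 n (f : 'rV[R]_n -> \bar R) :
  (forall x, (0 <= f x)%E) -> (0 <= iint f)%E.
Proof. by move=> f0; rewrite -(iint0 n); apply: iint_le. Qed.

(** The parameter space is arbitrary because the induction enlarges it: the first coordinate joins
    the parameter, giving a function on [S * R], and Tonelli makes its partial integral
    measurable. *)
Lemma measurable_iint n d (S : measurableType d) (F : S -> 'rV[R]_n -> \bar R) :
  (forall s x, (0 <= F s x)%E) -> jmeas F ->
  measurable_fun setT (fun s => iint (F s)).
Proof.
elim: n d S F => [|n IH] d S F F0 mF /=.
  by apply: (mF _ _ id (fun=> 0)) => // -[].
pose G (p : S * R) := iint (fun y => F p.1 (vcons p.2 y)).
have mG : measurable_fun setT G.
  apply: IH => [//|d2 S2 p x mp mx]; apply: (mF _ _ (fun s => (p s).1)).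
    exact: measurableT_comp.
  by apply: mrow_ins => //; exact: measurableT_comp.
by apply: (measurable_fun_fubini_tonelli_F (m2 := leb) G mG) => p; exact: iint_ge0.
Qed.

Lemma measurable_iint_ins n (j : 'I_n.+1) (f : 'rV[R]_n.+1 -> \bar R) :
  (forall x, (0 <= f x)%E) -> rmeas f ->
  measurable_fun setT (fun t => iint (fun y => f (ins j t y))).
Proof. by move=> f0 mf; apply: measurable_iint => // ; exact: jmeas_ins. Qed.

Lemma iintD n (f g : 'rV[R]_n -> \bar R) :
  (forall x, (0 <= f x)%E) -> rmeas f ->
  (forall x, (0 <= g x)%E) -> rmeas g ->
  iint (fun x => (f x + g x)%E) = (iint f + iint g)%E.
Proof.
elim: n f g => [//|n IH] f g f0 mf g0 mg /=.
rewrite -ge0_integralD//; first last.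
- exact: (measurable_iint_ins ord0).
- by move=> t _; exact: iint_ge0.
- exact: (measurable_iint_ins ord0).
- by move=> t _; exact: iint_ge0.
apply: eq_integral => t _; apply: IH => //; exact: (rmeas_ins ord0).
Qed.

Lemma iintZ n (k : R) (f : 'rV[R]_n -> \bar R) : 0 <= k ->
  (forall x, (0 <= f x)%E) -> rmeas f ->
  iint (fun x => (k%:E * f x)%E) = (k%:E * iint f)%E.
Proof.
move=> k0; elim: n f => [//|n IH] f f0 mf /=.
rewrite -ge0_integralZl_EFin//; first last.
- exact: (measurable_iint_ins ord0).
- by move=> t _; exact: iint_ge0.
apply: eq_integral => t _; apply: IH => //; exact: (rmeas_ins ord0).
Qed.

Lemma ins_swap n (j : 'I_n.+1) s t (y : 'rV[R]_n) :
  ins (lift ord0 j) t (vcons s y) = vcons s (ins j t y).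
Proof.
apply/rowP => i; rewrite vconsE.
case: (unliftP (lift ord0 j) i) => [k ->|->]; last first.
  by rewrite ins_at ins_lift ins_at.
rewrite ins_lift.
case: (unliftP ord0 k) => [k' ->|->].
  rewrite ins_lift.
  have -> : lift (lift ord0 j) (lift ord0 k') = lift ord0 (lift j k').
    by apply: val_inj; rewrite /= /bump !leq0n !add1n ltnS addnS.
  by rewrite ins_lift ins_lift.
have -> : lift (lift ord0 j) ord0 = ord0 by apply: val_inj.
by rewrite !ins_at.
Qed.

(* Tonelli: any coordinate may be integrated last. *)
Lemma iint_ins n (j : 'I_n.+1) (f : 'rV[R]_n.+1 -> \bar R) :
  (forall x, (0 <= f x)%E) -> rmeas f ->
  iint f = (\int[leb]_t iint (fun y => f (ins j t y)))%E.
Proof.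
elim: n j f => [|n IH] j f f0 mf; first by rewrite (ord1 j).
case: (unliftP ord0 j) => [j' ->|-> //].
transitivity (\int[leb]_s \int[leb]_t
   iint (fun y => f (vcons s (ins j' t y))))%E.
  apply: eq_integral => s _; apply: (IH j' (fun y => f (vcons s y))) => //.
  exact: (rmeas_ins ord0).
pose G (p : R * R) := iint (fun y => f (vcons p.1 (ins j' p.2 y))).
have mG : measurable_fun setT G.
  apply: measurable_iint => // d2 S2 p x mp mx; apply: mf.
  by do 2 (apply: mrow_ins; first exact: measurableT_comp).
have G0 p : (0 <= G p)%E by exact: iint_ge0.
rewrite (@fubini_tonelli _ _ _ _ _ leb leb G mG G0).
apply: eq_integral => t _; apply: eq_integral => s _.
by apply: eq_iint => y; rewrite ins_swap.
Qed.

Lemma mrow_reindex n p (s : 'I_p -> 'I_n) d (S : measurableType d)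
  (x : S -> 'rV[R]_n) : mrow x -> mrow (fun a => \row_i x a ord0 (s i)).
Proof. by move=> mx i; under eq_fun do rewrite mxE; exact: mx. Qed.

Lemma iint_reindex n (s : 'I_n -> 'I_n) (f : 'rV[R]_n -> \bar R) :
  injective s -> (forall x, (0 <= f x)%E) -> rmeas f ->
  iint (fun x => f (\row_i x ord0 (s i))) = iint f.
Proof.
elim: n s f => [|n IH] s f sI f0 mf.
  by rewrite /=; congr f; apply/rowP => -[].
have mfs : rmeas (fun x : 'rV[R]_n.+1 => f (\row_i x ord0 (s i))).
  by move=> d S x mx; apply: mf; exact: mrow_reindex.
rewrite (iint_ins (s ord0))//=; apply: eq_integral => t _.
have sN k : s ord0 != s (lift ord0 k).
  by apply/eqP => /sI /eqP; rewrite (negbTE (neq_lift _ _)).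
(* Coordinate [s ord0] of x becomes coordinate 0 of the argument of f; deleting these two indices
   leaves an injection [s'] on the remaining ones. *)
pose s' k := s2val (unlift_some (sN k)).
have s'E k : s (lift ord0 k) = lift (s ord0) (s' k) by exact: (s2valP (unlift_some (sN k))).
rewrite -(IH s' (fun y => f (vcons t y))); last 3 first.
- by move=> a b /(congr1 (lift (s ord0))); rewrite -!s'E => /sI /lift_inj.
- by [].
- exact: (rmeas_ins ord0).
apply: eq_iint => y; congr f; apply/rowP => i; rewrite vconsE !mxE.
case: (unliftP ord0 i) => [k ->|->]; last by rewrite unlift_none.
by rewrite s'E !liftK !mxE.
Qed.

Lemma row_mx_vcons a b t (z : 'rV[R]_a) (y : 'rV[R]_b) :
  row_mx (vcons t z) y = vcons t (row_mx z y) :> 'rV[R]_(a + b).+1.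
Proof.
apply/rowP => i; rewrite vconsE.
case: (unliftP ord0 i) => [k ->|->].
  rewrite ins_lift -(splitK (k : 'I_(a + b))); case: (fintype.split _) => c /=.
    have -> : lift ord0 (lshift b c) = lshift b (lift ord0 c) :> 'I_(a.+1 + b).
      by apply: val_inj.
    by rewrite (@row_mxEl _ _ a.+1) row_mxEl ins_lift.
  have -> : lift ord0 (rshift a c) = rshift a.+1 c :> 'I_(a.+1 + b).
    by apply: val_inj.
  by rewrite (@row_mxEr _ _ a.+1) row_mxEr.
rewrite ins_at.
have -> : ord0 = lshift b ord0 :> 'I_(a.+1 + b) by apply: val_inj.
by rewrite (@row_mxEl _ _ a.+1) ins_at.
Qed.

Lemma iint_split a b (f : 'rV[R]_(a + b) -> \bar R) :
  iint f = iint (fun z : 'rV[R]_a => iint (fun y : 'rV[R]_b => f (row_mx z y))).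
Proof.
elim: a f => [|a IH] f.
  by apply: eq_iint => y; congr f; rewrite row_thin_mx.
rewrite [LHS]/=; apply: eq_integral => t _; rewrite IH.
by apply: eq_iint => z; apply: eq_iint => y; rewrite row_mx_vcons.
Qed.

End IteratedIntegral.

(** * Affine changes of variable *)

Section Affine.
Variable R : realType.
Local Notation leb := (@lebesgue_measure R).

Lemma lebesgue_measure_affine_itv (a b x y : R) : a != 0 ->
  (leb `]x, y] = `|a|%:E * leb ((fun t => a * t + b)%R @^-1` `]x, y]))%E.
Proof.
rewrite lebesgue_measure_itv /= lte_fin neq_lt => /orP[a0|a0].
  have -> : (fun t => a * t + b) @^-1` `]x, y] =
      `[(y - b) / a, (x - b) / a[%classic.
    apply/seteqP; split=> t /=; rewrite !in_itv /= ler_ndivrMr// ltr_ndivlMr//.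
      by move=> /andP[? ?]; apply/andP; split; lra.
    by move=> /andP[? ?]; apply/andP; split; lra.
  rewrite lebesgue_measure_itv /= lte_fin ltr_nM2r ?invr_lt0// ltrD2r.
  rewrite (ltr0_norm a0); case: ifP => _; last by rewrite mule0.
  by rewrite -!EFinB -EFinM; congr EFin; field; rewrite lt_eqF.
have -> : (fun t => a * t + b) @^-1` `]x, y] =
    `](x - b) / a, (y - b) / a]%classic.
  apply/seteqP; split=> t /=; rewrite !in_itv /= ltr_pdivrMr// ler_pdivlMr//.
    by move=> /andP[? ?]; apply/andP; split; lra.
  by move=> /andP[? ?]; apply/andP; split; lra.
rewrite lebesgue_measure_itv /= lte_fin ltr_pM2r ?invr_gt0// ltrD2r.
rewrite (gtr0_norm a0); case: ifP => _; last by rewrite mule0.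
by rewrite -!EFinB -EFinM; congr EFin; field; rewrite gt_eqF.
Qed.

(** The pushforward scaled by [|a|] is a measure that agrees with Lebesgue measure on half-open
    intervals; uniqueness extends this to all measurable sets. *)
Lemma lebesgue_measure_affine (a b : R) (A : set R) : a != 0 -> measurable A ->
  (leb A = `|a|%:E * leb ((fun t => a * t + b)%R @^-1` A))%E.
Proof.
move=> a0 mA.
pose phi : measurableTypeR R -> measurableTypeR R := fun t => a * t + b.
have mphi : measurable_fun setT phi.
  by apply: measurable_funD => //; exact: measurable_funM.
pose nu := mscale (NngNum (normr_ge0 a)) (pushforward leb phi).
rewrite -[RHS]/(nu mphi A); apply: lebesgue_measure_unique => // _ [[x y]] _ <-.
exact: lebesgue_measure_affine_itv.
Qed.

Lemma integral_affine (a b : R) (f : R -> \bar R) : a != 0 ->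
  measurable_fun setT f -> (forall t, (0 <= f t)%E) ->
  (\int[leb]_t f t = `|a|%:E * \int[leb]_t f (a * t + b)%R)%E.
Proof.
move=> a0 mf f0.
pose phi : measurableTypeR R -> measurableTypeR R := fun t => a * t + b.
have mphi : measurable_fun setT phi.
  by apply: measurable_funD => //; exact: measurable_funM.
pose nu := mscale (NngNum (normr_ge0 a)) (pushforward leb phi).
transitivity (\int[nu mphi]_t f t)%E.
  apply: eq_measure_integral => A mA _ /=.
  exact: lebesgue_measure_affine.
rewrite ge0_integral_mscale//; congr (_ * _)%E.
by rewrite ge0_integral_pushforward.
Qed.

Lemma iint_affine n (a b : R) (f : 'rV[R]_n -> \bar R) : a != 0 ->
  rmeas f -> (forall x, (0 <= f x)%E) ->
  (iint f = (`|a| ^+ n)%:E * iint (fun x => f (\row_i (a * x ord0 i + b)%R)))%E.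
Proof.
move=> a0; elim: n f => [|n IH] f mf f0.
  by rewrite expr0 mul1e /=; congr f; apply/rowP => -[].
have E t y : \row_i (a * vcons t y ord0 i + b) =
    ins ord0 (a * t + b) (\row_i (a * y ord0 i + b)).
  apply/rowP => i; rewrite vconsE mxE.
  by case: (unliftP ord0 i) => [k ->|->]; rewrite ?ins_lift ?ins_at ?mxE.
rewrite /= (@integral_affine a b)//; last 2 first.
- exact: (measurable_iint_ins ord0).
- by move=> t; exact: iint_ge0.
have E2 t : iint (fun y => f (vcons (a * t + b)%R y)) =
    ((`|a| ^+ n)%:E * iint (fun y => f (\row_i (a * vcons t y ord0 i + b)%R)))%E.
  rewrite (IH (fun y => f (vcons (a * t + b)%R y)))//; last first.
    exact: (rmeas_ins ord0).
  by congr (_ * _)%E; apply: eq_iint => y; rewrite E.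
under eq_integral do rewrite E2.
rewrite ge0_integralZl_EFin//; last 2 first.
- by move=> t _; exact: iint_ge0.
- apply: (@measurable_iint_ins _ _ ord0 (fun x => f (\row_i (a * x ord0 i + b)%R))) => //.
  move=> d S x mx; apply: mf => i; under eq_fun do rewrite mxE.
  by apply: measurable_funD => //; exact: measurable_funM.
by rewrite muleA -EFinM exprS.
Qed.

End Affine.

(** * Measurable sets of rows; Lipschitz functions are measurable *)

Section RowSets.
Variable R : realType.

Definition rset n (A : set 'rV[R]_n) :=
  forall d (S : measurableType d) (x : S -> 'rV[R]_n),
    mrow x -> measurable (x @^-1` A).

Lemma rmeas_indic n (A : set 'rV[R]_n) : rset A -> rmeas (\1_A : 'rV[R]_n -> R).
Proof.
move=> mA d S x mx; rewrite (_ : (fun s => _) = \1_(x @^-1` A)); last first.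
  by apply/funext => s; rewrite !indicE.
by apply: measurable_indic; exact: mA.
Qed.

Lemma rmeas_cst n d (T : measurableType d) (c : T) :
  rmeas (fun _ : 'rV[R]_n => c).
Proof. by []. Qed.

Lemma rmeas_coord n (i : 'I_n) : rmeas (fun x : 'rV[R]_n => x ord0 i).
Proof. by move=> d S x; apply. Qed.

Lemma rmeasD n (f g : 'rV[R]_n -> R) : rmeas f -> rmeas g ->
  rmeas (fun x => f x + g x).
Proof. by move=> mf mg d S x mx; apply: measurable_funD; [exact: mf|exact: mg]. Qed.

Lemma rmeasM n (f g : 'rV[R]_n -> R) : rmeas f -> rmeas g ->
  rmeas (fun x => f x * g x).
Proof. by move=> mf mg d S x mx; apply: measurable_funM; [exact: mf|exact: mg]. Qed.

Lemma rmeas_sum n (I : Type) (s : seq I) (f : I -> 'rV[R]_n -> R) :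
  (forall i, rmeas (f i)) -> rmeas (fun x => \sum_(i <- s) f i x).
Proof.
by move=> mf d S x mx; apply: measurable_sum => i; exact: mf.
Qed.

Lemma rmeas_EFin n (f : 'rV[R]_n -> R) : rmeas f -> rmeas (fun x => (f x)%:E).
Proof. by move=> mf d S x mx; apply/measurable_EFinP; exact: mf. Qed.

Lemma rmeas_comp n p d (T : measurableType d) (f : 'rV[R]_p -> T)
    (g : 'rV[R]_n -> 'rV[R]_p) :
  rmeas f -> (forall i, rmeas (fun x => g x ord0 i)) -> rmeas (fun x => f (g x)).
Proof.
by move=> mf mg d' S x mx; apply: (mf _ _ (fun s => g (x s))) => i; exact: mg.
Qed.

Lemma rset_comp n p (A : set 'rV[R]_p) (g : 'rV[R]_n -> 'rV[R]_p) :
  rset A -> (forall i, rmeas (fun x => g x ord0 i)) -> rset (g @^-1` A).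
Proof.
by move=> mA mg d S x mx; apply: (mA _ _ (fun s => g (x s))) => i; exact: mg.
Qed.

Lemma rset_le n (f g : 'rV[R]_n -> R) : rmeas f -> rmeas g ->
  rset [set x | f x <= g x].
Proof.
move=> mf mg d S x mx; rewrite /preimage/= -[X in measurable X]setTI.
exact: (measurable_fun_ler (mf _ _ _ mx) (mg _ _ _ mx) measurableT).
Qed.

Lemma rsetI n (A B : set 'rV[R]_n) : rset A -> rset B -> rset (A `&` B).
Proof. by move=> mA mB d S x mx; apply: measurableI; [exact: mA|exact: mB]. Qed.

Lemma rsetC n (A : set 'rV[R]_n) : rset A -> rset (~` A).
Proof. by move=> mA d S x mx; apply: measurableC; exact: mA. Qed.

Lemma rset_lt n (f g : 'rV[R]_n -> R) : rmeas f -> rmeas g ->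
  rset [set x | f x < g x].
Proof.
move=> mf mg; rewrite (_ : mkset _ = ~` [set x | g x <= f x]).
  by apply: rsetC; exact: rset_le.
by apply/seteqP; split=> x /=; rewrite ltNge => /negP.
Qed.

Lemma rset_forall n (I : finType) (A : I -> set 'rV[R]_n) :
  (forall i, rset (A i)) -> rset [set x | forall i, A i x].
Proof.
move=> mA d S x mx; rewrite (_ : _ @^-1` _ = \bigcap_(i in [set: I]) (x @^-1` A i)).
  by apply: fin_bigcap_measurable => // i _; exact: mA.
by apply/seteqP; split=> [s h i _|s h i]; [exact: (h i)|exact: (h i Logic.I)].
Qed.

Lemma rset_imply n (P : Prop) (A : set 'rV[R]_n) :
  rset A -> rset [set x | P -> A x].
Proof.
move=> mA d S x mx; have [p|p] := pselect P.
  rewrite (_ : _ @^-1` _ = x @^-1` A); first exact: mA.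
  by apply/seteqP; split=> s /=; [apply|].
rewrite (_ : _ @^-1` _ = setT); first exact: measurableT.
by apply/seteqP; split=> s //= _ /p.
Qed.

(** The l^1 distance fits the problem: allocations lie in [0,1], so indirect utilities have constant
    1 for it, and so have sums over bundles. *)
Definition lip1 n (f : 'rV[R]_n -> R) :=
  forall x y, `|f x - f y| <= \sum_i `|x ord0 i - y ord0 i|.

(* McShane: a Lipschitz function is a countable supremum of the functions
   f q - |x - q|_1 with q rational. *)
Lemma rmeas_lip1 n (f : 'rV[R]_n -> R) : lip1 f -> rmeas f.
Proof.
move=> lf d S x mx _; apply: (measurability _ (RGenOInfty.measurableE R)) => //.
move=> _ [_ [c ->] <-]; rewrite setTI preimage_itvoy.
(* The rational rows are enumerated by their codes; a code that decodes to nothing contributes the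
   empty set. *)
pose q (k : nat) : option 'rV[R]_n :=
  omap (map_mx ratr) (unpickle k : option 'rV[rat]_n).
rewrite (_ : [set s | c < f (x s)] = \bigcup_k
   (if q k is Some z then
      [set s | c < f z - \sum_i `|x s ord0 i - z ord0 i|] else set0)).
  apply: bigcupT_measurable => k; case: (q k) => // z.
  rewrite -preimage_itvoy -[X in measurable X]setTI.
  suff : measurable_fun setT (fun s => f z - \sum_i `|x s ord0 i - z ord0 i|).
    by apply => //; exact: measurable_itv.
  apply: measurable_funB => //; apply: measurable_sum => i.
  apply: measurableT_comp => //; apply: measurable_funB => //; exact: mx.
apply/seteqP; split=> s /=.
  (* Replacing x by a rational row z within e in each coordinate costs n * e in f and n * e in the
     subtracted distance; the extra 1 keeps the inequality strict. *)
  move=> cf; pose e := (f (x s) - c) / (n%:R + n%:R + 1).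
  have e0 : 0 < e by rewrite divr_gt0 ?subr_gt0// ltr_wpDl.
  have Hz i : {r : rat | `|x s ord0 i - ratr r| < e}.
    apply: cid.
    have : x s ord0 i - e < x s ord0 i + e by rewrite ltrBlDr -addrA ltrDl addr_gt0.
    move=> /rat_in_itvoo[r]; rewrite in_itv /= => /andP[r1 r2]; exists r.
    by rewrite ltr_norml; apply/andP; split; lra.
  pose z : 'rV[rat]_n := \row_i projT1 (Hz i).
  exists (pickle z) => //; rewrite /q pickleK /=.
  have le_e : \sum_i `|x s ord0 i - map_mx ratr z ord0 i| <= n%:R * e.
    rewrite mulr_natl -[X in _ *+ X]card_ord -sumr_const; apply: ler_sum => i _.
    by rewrite !mxE; exact: ltW (projT2 (Hz i)).
  have := lf (x s) (map_mx ratr z); rewrite ler_norml => /andP[_ h].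
  rewrite ltrBrDr; apply: (@le_lt_trans _ _ (c + n%:R * e)); first by rewrite lerD2l.
  apply: (@lt_le_trans _ _ (f (x s) - n%:R * e)); last by lra.
  have -> : f (x s) = c + (n%:R + n%:R + 1) * e.
    rewrite /e mulrCA divff ?mulr1; first by rewrite addrC subrK.
    by rewrite gt_eqF// ltr_wpDl.
  by rewrite !mulrDl mul1r; lra.
move=> [k _]; case: (q k) => // z /= h; apply: (lt_le_trans h).
by have := lf z (x s); rewrite ler_norml => /andP[_];
  under eq_bigr do rewrite distrC; lra.
Qed.

Lemma continuous_lip1 n (f : 'rV[R]_n -> R) : lip1 f -> continuous f.
Proof.
move=> lf x; apply/(@cvgrPdist_lt _ _ _ _ (nbhs_filter x)) => e e0.
have e1 : 0 < e / (n%:R + 1) by rewrite divr_gt0// ltr_wpDl.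
apply/nbhs_ballP; exists (e / (n%:R + 1)) => //= y [_ xy].
apply: (le_lt_trans (lf _ _)).
apply: (@le_lt_trans _ _ (n%:R * (e / (n%:R + 1)))).
  rewrite mulr_natl -[X in _ *+ X]card_ord -sumr_const; apply: ler_sum => i _.
  by have := xy ord0 i; rewrite -ball_normE /= => /ltW.
by rewrite mulrCA gtr_pMr// ltr_pdivrMr ?mul1r ?ltrDl// ltr_wpDl.
Qed.

End RowSets.

(** * Integration over the unit cube *)

Section CubeIntegral.
Variable R : realType.
Local Notation leb := (@lebesgue_measure R).
Implicit Types n : nat.

Definition icube n (f : 'rV[R]_n -> R) : \bar R :=
  iint (fun x => (\1_(cube n) x * f x)%:E).

(** [fine] turns infinite values into 0; for [bmeas] functions nothing is lost, by [icubeE]. *)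
Definition cint n (f : 'rV[R]_n -> R) : R := fine (icube f).

Definition bmeas n (f : 'rV[R]_n -> R) :=
  rmeas f /\ exists C, forall x, cube n x -> `|f x| <= C.

Lemma rset_cube n : rset (@cube R n).
Proof.
apply: rset_forall => i.
rewrite (_ : (fun _ => _) = [set x : 'rV[R]_n | 0 <= x ord0 i] `&` [set x : 'rV[R]_n | x ord0 i <= 1]).
  by apply: rsetI; apply: rset_le => //; exact: rmeas_coord.
by apply/seteqP; split=> x /= /andP.
Qed.

Lemma rmeas_icube n (f : 'rV[R]_n -> R) : rmeas f ->
  rmeas (fun x => (\1_(cube n) x * f x)%:E).
Proof.
by move=> mf; apply: rmeas_EFin; apply: rmeasM => //; apply: rmeas_indic; exact: rset_cube.
Qed.

Lemma cube_ins n (j : 'I_n.+1) t (y : 'rV[R]_n) :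
  cube n.+1 (ins j t y) <-> 0 <= t <= 1 /\ cube n y.
Proof.
split=> [h|[t01 h] i].
  by split=> [|i]; [have := h j; rewrite ins_at|have := h (lift j i); rewrite ins_lift].
by case: (unliftP j i) => [k ->|->]; rewrite ?ins_at// ins_lift; exact: h.
Qed.

Lemma indic_cube_ins n (j : 'I_n.+1) t (y : 'rV[R]_n) :
  \1_(cube n.+1) (ins j t y) = \1_(`[0%R, 1%R]%classic) t * \1_(cube n) y :> R.
Proof.
rewrite !indicE -natrM mulnb; congr (nat_of_bool _)%:R.
apply/idP/andP => [/set_mem /cube_ins[t01 cy]|[/set_mem t01 /set_mem cy]].
  by split; apply/mem_set => //=; rewrite in_itv.
by apply/mem_set/cube_ins; split => //; move: t01; rewrite /= in_itv.
Qed.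

Lemma indic_cube01 n (x : 'rV[R]_n) : 0 <= \1_(cube n) x :> R.
Proof. by rewrite indicE. Qed.

Lemma icube_ge0 n (f : 'rV[R]_n -> R) : (forall x, 0 <= f x) -> (0 <= icube f)%E.
Proof. by move=> f0; apply: iint_ge0 => x; rewrite lee_fin mulr_ge0. Qed.

Lemma icube_ins n (j : 'I_n.+1) (f : 'rV[R]_n.+1 -> R) :
  rmeas f -> (forall x, 0 <= f x) ->
  icube f = (\int[leb]_t ((\1_(`[0%R, 1%R]%classic) t)%:E * icube (fun y => f (ins j t y))))%E.
Proof.
move=> mf f0; rewrite /icube (iint_ins j)//; last 2 first.
- by move=> x; rewrite lee_fin mulr_ge0.
- exact: rmeas_icube.
apply: eq_integral => t _; rewrite -iintZ//.
- by apply: eq_iint => y; rewrite indic_cube_ins -mulrA EFinM.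
- by move=> x; rewrite lee_fin mulr_ge0.
- by apply: rmeas_icube; exact: rmeas_ins.
Qed.

Lemma measurable_icube_ins n (j : 'I_n.+1) (f : 'rV[R]_n.+1 -> R) :
  rmeas f -> (forall x, 0 <= f x) ->
  measurable_fun setT (fun t => icube (fun y => f (ins j t y))).
Proof.
move=> mf f0; apply: measurable_iint => [t x|]; first by rewrite lee_fin mulr_ge0.
move=> d S p x mp mx; apply/measurable_EFinP; apply: measurable_funM.
  by apply: rmeas_indic => //; exact: rset_cube.
by apply: mf; exact: mrow_ins.
Qed.

Lemma le_icube n (f g : 'rV[R]_n -> R) :
  (forall x, cube n x -> f x <= g x) -> (icube f <= icube g)%E.
Proof.
move=> fg; apply: iint_le => x; rewrite lee_fin indicE.
by case: (boolP (_ \in _)) => [/set_mem/fg|_]; rewrite ?mul1r ?mul0r.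
Qed.

Lemma eq_icube n (f g : 'rV[R]_n -> R) :
  (forall x, cube n x -> f x = g x) -> icube f = icube g.
Proof.
by move=> fg; apply/eqP; rewrite eq_le; apply/andP; split; apply: le_icube => x /fg ->.
Qed.

Lemma icubeD n (f g : 'rV[R]_n -> R) :
  rmeas f -> (forall x, cube n x -> 0 <= f x) ->
  rmeas g -> (forall x, cube n x -> 0 <= g x) ->
  icube (fun x => f x + g x) = (icube f + icube g)%E.
Proof.
have pos (h : 'rV[R]_n -> R) : (forall x, cube n x -> 0 <= h x) ->
    forall x, (0 <= (\1_(cube n) x * h x)%:E)%E.
  move=> h0 x; rewrite lee_fin indicE.
  by case: (boolP (_ \in _)) => [/set_mem/h0|_]; rewrite ?mul1r ?mul0r.
move=> mf f0 mg g0; rewrite /icube -iintD//; try exact: pos; try exact: rmeas_icube.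
by apply: eq_iint => x; rewrite mulrDr EFinD.
Qed.

Lemma icubeZ n k (f : 'rV[R]_n -> R) : 0 <= k -> rmeas f ->
  (forall x, 0 <= f x) -> icube (fun x => k * f x) = (k%:E * icube f)%E.
Proof.
move=> k0 mf f0; rewrite /icube -iintZ//.
- by apply: eq_iint => x; rewrite mulrCA EFinM.
- by move=> x; rewrite lee_fin mulr_ge0.
- exact: rmeas_icube.
Qed.

Lemma icube1 n : icube (fun _ : 'rV[R]_n => 1) = 1%E.
Proof.
elim: n => [|n IH].
  by rewrite /icube /= mulr1 indicE mem_set// => -[].
rewrite (icube_ins ord0)//; under eq_integral do rewrite IH mule1.
rewrite (_ : (fun x => _) = (fun x => (\1_(`[0%R, 1%R]%classic) x)%:E))//.
rewrite integral_indic// setIT; apply: (etrans (lebesgue_measure_itv _)).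
by rewrite /= lte_fin ltr01 oppr0 adde0.
Qed.

Lemma icube_cst n c : 0 <= c -> icube (fun _ : 'rV[R]_n => c) = c%:E.
Proof.
move=> c0; rewrite -[RHS]mule1 -(icube1 n) -icubeZ//.
by apply: eq_icube => x _; rewrite mulr1.
Qed.

(** The integrand on the left is signed, out of reach of the results for nonnegative functions. One
    coordinate is peeled off at a time, and the common bound C makes both slice integrals integrable
    in it. *)
Lemma icubeB n (f g : 'rV[R]_n -> R) C :
  rmeas f -> (forall x, 0 <= f x) -> (forall x, cube n x -> f x <= C) ->
  rmeas g -> (forall x, 0 <= g x) -> (forall x, cube n x -> g x <= C) ->
  icube (fun x => f x - g x) = (icube f - icube g)%E.
Proof.
elim: n f g => [|n IH] f g mf f0 fC mg g0 gC.
  by rewrite /icube /= -EFinB; congr EFin; rewrite mulrBr.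
have C0 : 0 <= C by apply: le_trans (f0 (const_mx 0)) (fC _ _) => i; rewrite mxE lexx ler01.
pose A (h : 'rV[R]_n.+1 -> R) (t : R) := ((\1_(`[0%R, 1%R]%classic) t)%:E * icube (fun y => h (ins ord0 t y)))%E.
have fin (h : 'rV[R]_n.+1 -> R) : rmeas h -> (forall x, 0 <= h x) -> (forall x, cube n.+1 x -> h x <= C) ->
   leb.-integrable setT (A h).
  move=> mh h0 hC; apply/integrableP; split.
    apply: emeasurable_funM.
      by apply/measurable_EFinP; exact: measurable_indic.
    exact: measurable_icube_ins.
  under eq_integral do rewrite gee0_abs ?mule_ge0 ?lee_fin// ?icube_ge0//.
  rewrite -icube_ins//; apply: (@le_lt_trans _ _ C%:E); last by rewrite ltry.
  by rewrite -(icube_cst n.+1 C0); exact: le_icube.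
rewrite (icube_ins ord0 mf f0) (icube_ins ord0 mg g0) -integralB//; last 2 first.
- exact: fin.
- exact: fin.
rewrite /icube /=; apply: eq_integral => t _ /=.
rewrite (_ : iint _ = iint (fun y => (\1_(`[0%R, 1%R]%classic) t * (\1_(cube n) y *
  (f (ins ord0 t y) - g (ins ord0 t y))))%:E)); last first.
  by apply: eq_iint => y; rewrite vconsE indic_cube_ins mulrA.
rewrite /A indicE; case: (boolP (_ \in _)) => [t01|_]; last first.
  by rewrite !mul0e subee//; under eq_iint do rewrite mul0r; rewrite iint0.
rewrite !mul1e -(IH (fun y => f (ins ord0 t y)) (fun y => g (ins ord0 t y))); last 6 first.
- exact: rmeas_ins.
- by [].
- by move=> x cx; apply: fC; apply/cube_ins; move/set_mem: t01; rewrite /= in_itv.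
- exact: rmeas_ins.
- by [].
- by move=> x cx; apply: gC; apply/cube_ins; move/set_mem: t01; rewrite /= in_itv.
by apply: eq_iint => y; rewrite mul1r.
Qed.

Lemma bmeas_bound n (f : 'rV[R]_n -> R) : bmeas f ->
  exists C, 0 <= C /\ forall x, cube n x -> - C <= f x <= C.
Proof.
move=> [_ [C h]]; exists C; split; last by move=> x /h; rewrite ler_norml.
apply: (le_trans (normr_ge0 _) (h (const_mx 0) _)) => i.
by rewrite mxE lexx ler01.
Qed.

End CubeIntegral.

(** * Linearity of the real-valued cube integral *)

Section CubeCalculus.
Variable R : realType.
Implicit Types n : nat.

(** Reduces a bounded signed function to a nonnegative one with finite integral; linearity is then
    transported from the nonnegative case. *)
Lemma icube_shift n (f : 'rV[R]_n -> R) C D :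
  rmeas f -> (forall x, cube n x -> - C <= f x <= C) -> C <= D -> 0 <= D ->
  icube f = (icube (fun x => (f x + D)%R) - D%:E)%E /\
  exists2 r, 0 <= r & icube (fun x => (f x + D)%R) = r%:E.
Proof.
(* The shifted function is nonnegative on the cube only; the indicator makes it so everywhere. *)
move=> mf fC CD D0; pose f' x := \1_(cube n) x * (f x + D).
have mf' : rmeas f'.
  by apply: rmeasM; [apply: rmeas_indic; exact: rset_cube|exact: rmeasD].
have f'E x : cube n x -> f' x = f x + D.
  by move=> cx; rewrite /f' indicE mem_set// mul1r.
have f'0 x : 0 <= f' x.
  rewrite /f' indicE; case: (boolP (x \in _)) => [/set_mem/fC/andP[h _]|_].
    by rewrite mul1r; lra.
  by rewrite mul0r.
have f'C x : cube n x -> f' x <= D + D.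
  by move=> cx; rewrite f'E//; have /andP[_ h] := fC _ cx; lra.
rewrite -(@eq_icube _ _ f' (fun x => f x + D))//; split.
  rewrite -(icube_cst n D0) -(@icubeB _ _ _ _ (D + D))//; last first.
    by move=> x _; lra.
  by apply: eq_icube => x cx; rewrite f'E// addrK.
exists (fine (icube f')); first by rewrite fine_ge0// icube_ge0.
rewrite fineK// ge0_fin_numE ?icube_ge0//.
apply: (@le_lt_trans _ _ (D + D)%:E); last by rewrite ltry.
by rewrite -(@icube_cst _ n (D + D)) ?addr_ge0//; exact: le_icube.
Qed.

Lemma icubeE n (f : 'rV[R]_n -> R) : bmeas f -> icube f = (cint f)%:E.
Proof.
move=> nf; have [C [C0 fC]] := bmeas_bound nf.
have [e [r _ er]] := icube_shift nf.1 fC (lexx _) C0.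
by rewrite /cint e er.
Qed.

Lemma bmeas_cst n (c : R) : bmeas (fun _ : 'rV[R]_n => c).
Proof. by split=> //; exists `|c|. Qed.

Lemma bmeasD n (f g : 'rV[R]_n -> R) : bmeas f -> bmeas g -> bmeas (fun x => f x + g x).
Proof.
move=> [mf [C fC]] [mg [D gD]]; split; first exact: rmeasD.
by exists (C + D) => x cx; rewrite (le_trans (ler_normD _ _))// lerD ?fC ?gD.
Qed.

Lemma bmeasM n (f g : 'rV[R]_n -> R) : bmeas f -> bmeas g -> bmeas (fun x => f x * g x).
Proof.
move=> [mf [C fC]] [mg [D gD]]; split; first exact: rmeasM.
by exists (C * D) => x cx; rewrite normrM ler_pM ?fC ?gD.
Qed.

Lemma bmeasZ n k (f : 'rV[R]_n -> R) : bmeas f -> bmeas (fun x => k * f x).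
Proof. by move=> nf; apply: bmeasM => //; exact: bmeas_cst. Qed.

Lemma bmeasB n (f g : 'rV[R]_n -> R) : bmeas f -> bmeas g -> bmeas (fun x => f x - g x).
Proof.
move=> nf ng; rewrite (_ : (fun x => _) = (fun x => f x + (-1) * g x)).
  by apply: bmeasD => //; exact: bmeasZ.
by apply/funext => x; rewrite mulN1r.
Qed.

Lemma bmeas_sum n (I : Type) (s : seq I) (P : pred I) (f : I -> 'rV[R]_n -> R) :
  (forall i, bmeas (f i)) -> bmeas (fun x => \sum_(i <- s | P i) f i x).
Proof.
move=> nf; elim: s => [|i s IH].
  under eq_fun do rewrite big_nil; exact: bmeas_cst.
under eq_fun do rewrite big_cons; case: (P i) => //; exact: bmeasD.
Qed.

Lemma bmeas_indic n (A : set 'rV[R]_n) : rset A -> bmeas (\1_A : 'rV[R]_n -> R).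
Proof.
move=> mA; split; first exact: rmeas_indic.
by exists 1 => x _; rewrite indicE; case: (_ \in _); rewrite ?normr1 ?normr0.
Qed.

Lemma bmeas_comp n p (f : 'rV[R]_p -> R) (g : 'rV[R]_n -> 'rV[R]_p) :
  bmeas f -> (forall i, rmeas (fun x => g x ord0 i)) ->
  (forall x, cube n x -> cube p (g x)) -> bmeas (fun x => f (g x)).
Proof.
move=> [mf [C fC]] mg cg; split; first exact: rmeas_comp.
by exists C => x /cg /fC.
Qed.

Lemma le_cint n (f g : 'rV[R]_n -> R) : bmeas f -> bmeas g ->
  (forall x, cube n x -> f x <= g x) -> cint f <= cint g.
Proof. by move=> nf ng fg; rewrite -lee_fin -!icubeE//; exact: le_icube. Qed.

Lemma eq_cint n (f g : 'rV[R]_n -> R) :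
  (forall x, cube n x -> f x = g x) -> cint f = cint g.
Proof. by move=> fg; rewrite /cint (eq_icube fg). Qed.

Lemma cint_cst n (c : R) : cint (fun _ : 'rV[R]_n => c) = c.
Proof.
have C1 (x : 'rV[R]_n) : cube n x -> - `|c| <= c <= `|c|.
  by move=> _; rewrite -ler_norml.
have [e _] := icube_shift (@bmeas_cst n c).1 C1 (lexx _) (normr_ge0 c).
rewrite /cint e icube_cst -?EFinB ?addrK//.
by have := C1 (const_mx 0); rewrite -lerBlDr sub0r => /(_ _)/andP[]// i; rewrite mxE lexx ler01.
Qed.

Lemma cintD n (f g : 'rV[R]_n -> R) : bmeas f -> bmeas g ->
  cint (fun x => f x + g x) = cint f + cint g.
Proof.
move=> nf ng; have [C [C0 fC]] := bmeas_bound nf; have [D [D0 gD]] := bmeas_bound ng.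
have nfg := bmeasD nf ng.
have fgCD x : cube n x -> - (C + D) <= f x + g x <= C + D.
  by move=> cx; have /andP[? ?] := fC _ cx; have /andP[? ?] := gD _ cx; apply/andP; split; lra.
have [ef [r r0 er]] := icube_shift nf.1 fC (lexx _) C0.
have [eg [s s0 es]] := icube_shift ng.1 gD (lexx _) D0.
have [efg _] := icube_shift nfg.1 fgCD (lexx _) (addr_ge0 C0 D0).
apply: EFin_inj; rewrite EFinD -!icubeE// ef eg efg er es.
rewrite (_ : icube _ = (r + s)%:E); first by rewrite -!EFinB -EFinD; congr EFin; lra.
rewrite EFinD -er -es -icubeD.
- by apply: eq_icube => x _; lra.
- exact: (rmeasD nf.1).
- by move=> x /fC/andP[? ?]; lra.
- exact: (rmeasD ng.1).
- by move=> x /gD/andP[? ?]; lra.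
Qed.

Lemma cintZ n k (f : 'rV[R]_n -> R) : bmeas f -> cint (fun x => k * f x) = k * cint f.
Proof.
move=> nf.
have pos l : 0 <= l -> cint (fun x => l * f x) = l * cint f.
  move=> l0; have [C [C0 fC]] := bmeas_bound nf.
  have [ef [r r0 er]] := icube_shift nf.1 fC (lexx _) C0.
  pose f' x := \1_(cube n) x * (f x + C).
  have f'E x : cube n x -> f' x = f x + C.
    by move=> cx; rewrite /f' indicE mem_set// mul1r.
  have f'0 x : 0 <= f' x.
    rewrite /f' indicE; case: (boolP (x \in _)) => [/set_mem/fC/andP[h _]|_].
      by rewrite mul1r; lra.
    by rewrite mul0r.
  have mf' : rmeas f'.
    by apply: rmeasM; [apply: rmeas_indic; exact: rset_cube|exact: (rmeasD nf.1)].
  have lC x : cube n x -> - (l * C) <= l * f x <= l * C.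
    by move=> /fC/andP[h1 h2]; rewrite -mulrN !ler_wpM2l.
  have [elf _] := icube_shift (bmeasZ l nf).1 lC (lexx _) (mulr_ge0 l0 C0).
  apply: EFin_inj; rewrite EFinM -!icubeE//; last exact: bmeasZ.
  rewrite ef elf er.
  rewrite (_ : icube _ = (l * r)%:E); first by rewrite -!EFinB -EFinM; congr EFin; lra.
  rewrite EFinM -er -(@eq_icube _ _ f' (fun x => f x + C))// -icubeZ//.
  by apply: eq_icube => x cx; rewrite f'E// mulrDr.
have [k0|k0] := leP 0 k; first exact: pos.
have := cintD (bmeasZ k nf) (bmeasZ (- k) nf).
rewrite (pos (- k)) ?oppr_ge0 ?ltW// => h.
have : cint (fun x => k * f x + - k * f x) = 0.
  rewrite -[RHS](cint_cst n 0); apply: eq_cint => x _; lra.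
by rewrite h; lra.
Qed.

Lemma cintB n (f g : 'rV[R]_n -> R) : bmeas f -> bmeas g ->
  cint (fun x => f x - g x) = cint f - cint g.
Proof.
move=> nf ng; rewrite -[- cint g]mulN1r -cintZ// -cintD//; last exact: bmeasZ.
by apply: eq_cint => x _; rewrite mulN1r.
Qed.

Lemma cint_sum n (I : Type) (s : seq I) (P : pred I) (f : I -> 'rV[R]_n -> R) :
  (forall i, bmeas (f i)) ->
  cint (fun x => \sum_(i <- s | P i) f i x) = \sum_(i <- s | P i) cint (f i).
Proof.
move=> nf; elim: s => [|i s IH].
  rewrite big_nil -[RHS](cint_cst n 0); apply: eq_cint => x _; exact: big_nil.
rewrite big_cons; have e : cint (fun x => \sum_(j <- i :: s | P j) f j x) =
    cint (fun x => if P i then f i x + \sum_(j <- s | P j) f j x else \sum_(j <- s | P j) f j x).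
  by apply: eq_cint => x _; rewrite big_cons.
rewrite e; case: (P i) => //; rewrite cintD ?IH//; exact: bmeas_sum.
Qed.

Lemma cint_ge0 n (f : 'rV[R]_n -> R) : (forall x, 0 <= f x) -> 0 <= cint f.
Proof. by move=> f0; rewrite fine_ge0// icube_ge0. Qed.

End CubeCalculus.

(** * Overwriting and rescaling one coordinate *)

Section Coordinate.
Variable R : realType.
Local Notation leb := (@lebesgue_measure R).
Implicit Types n : nat.

(** Unlike [ins], this keeps the dimension: an integral over the face x_j = t becomes a cube
    integral of a function constant in x_j, see [icube_setc]. *)
Definition setc n (x : 'rV[R]_n) (j : 'I_n) (t : R) : 'rV[R]_n :=
  \row_i if i == j then t else x ord0 i.

Lemma setc_at n (x : 'rV[R]_n) j t : setc x j t ord0 j = t.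
Proof. by rewrite mxE eqxx. Qed.

Lemma setc_other n (x : 'rV[R]_n) j t i : i != j -> setc x j t ord0 i = x ord0 i.
Proof. by move=> ij; rewrite mxE (negbTE ij). Qed.

Lemma setc_id n (x : 'rV[R]_n) j : setc x j (x ord0 j) = x.
Proof. by apply/rowP => i; rewrite mxE; case: eqP => // ->. Qed.

Lemma setc_ins n (j : 'I_n.+1) t t' (y : 'rV[R]_n) :
  setc (ins j t y) j t' = ins j t' y.
Proof.
apply/rowP => i; case: (unliftP j i) => [k ->|->].
  by rewrite setc_other ?neq_lift// 1?eq_sym ?neq_lift// !ins_lift.
by rewrite setc_at ins_at.
Qed.

Lemma cube_setc n (x : 'rV[R]_n) j t : cube n x -> 0 <= t <= 1 -> cube n (setc x j t).
Proof. by move=> cx t01 i; rewrite mxE; case: eqP. Qed.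

Lemma rmeas_setc n (j : 'I_n) (g : 'rV[R]_n -> R) : rmeas g ->
  forall i, rmeas (fun x => setc x j (g x) ord0 i).
Proof.
move=> mg i; rewrite (_ : (fun x => _) = if i == j then g else fun x => x ord0 i).
  by case: eqP => // _; exact: rmeas_coord.
by apply/funext => x; rewrite mxE; case: eqP.
Qed.

Lemma bmeas_setc n (f : 'rV[R]_n -> R) j t : bmeas f -> 0 <= t <= 1 ->
  bmeas (fun x => f (setc x j t)).
Proof.
move=> nf t01; apply: bmeas_comp => // [|x cx]; last exact: cube_setc.
exact: rmeas_setc.
Qed.

Lemma icube_setc n (j : 'I_n.+1) (f : 'rV[R]_n.+1 -> R) t :
  rmeas f -> (forall x, 0 <= f x) ->
  icube (fun x => f (setc x j t)) = icube (fun y => f (ins j t y)).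
Proof.
move=> mf f0; rewrite (icube_ins j)//; last first.
  by apply: rmeas_comp => //; exact: rmeas_setc.
under eq_integral => u _.
  rewrite (_ : icube _ = icube (fun y => f (ins j t y))); last first.
    by apply: eq_icube => y _; rewrite setc_ins.
  rewrite muleC; over.
rewrite /= ge0_integralZl//; last 2 first.
- by apply/measurable_EFinP; exact: measurable_indic.
- exact: icube_ge0.
rewrite integral_indic// setIT (_ : _ `[0%R, 1%R]%classic = 1%E) ?mule1//.
apply: (etrans (lebesgue_measure_itv _)).
by rewrite /= lte_fin ltr01 oppr0 adde0.
Qed.

Lemma measurable_mul_indic (W : R -> \bar R) (A : set R) :
  measurable A -> measurable_fun setT W ->
  measurable_fun setT (fun t => ((\1_A t)%:E * W t)%E).
Proof.
move=> mA mW; apply: emeasurable_funM => //.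
by apply/measurable_EFinP; exact: measurable_indic.
Qed.

Lemma integral_indic_scale (W : R -> \bar R) s : 0 < s ->
  measurable_fun setT W -> (forall t, (0 <= W t)%E) ->
  (s%:E * \int[leb]_t ((\1_(`[0%R, 1%R]%classic) t)%:E * W (s * t)%R) =
   \int[leb]_t ((\1_(`[0%R, s]%classic) t)%:E * W t))%E.
Proof.
move=> s0 mW W0; rewrite [RHS](@integral_affine _ s 0) ?gt_eqF//; last 2 first.
- exact: measurable_mul_indic.
- by move=> t; rewrite mule_ge0// lee_fin.
rewrite gtr0_norm//; congr (_ * _)%E; apply: eq_integral => t _.
rewrite addr0; congr (_%:E * _)%E; rewrite !indicE; congr (nat_of_bool _)%:R.
apply/idP/idP => /set_mem /=; rewrite in_itv /= => h;
  apply/mem_set; move: h; rewrite /= in_itv /=; last by rewrite pmulr_rge0// ger_pMr.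
by rewrite pmulr_rge0// ger_pMr.
Qed.

Lemma integral_indic_split (W : R -> \bar R) a b : 0 <= a -> a <= b ->
  measurable_fun setT W -> (forall t, (0 <= W t)%E) ->
  (\int[leb]_t ((\1_(`[0%R, b]%classic) t)%:E * W t) =
   \int[leb]_t ((\1_(`[0%R, a]%classic) t)%:E * W t) +
   \int[leb]_t ((\1_(`]a, b]%classic) t)%:E * W t))%E.
Proof.
move=> a0 ab mW W0; rewrite -ge0_integralD//; first last.
- exact: measurable_mul_indic.
- by move=> t _; rewrite mule_ge0// lee_fin.
- exact: measurable_mul_indic.
- by move=> t _; rewrite mule_ge0// lee_fin.
apply: eq_integral => t _; rewrite -ge0_muleDl ?lee_fin// -EFinD; congr (_%:E * _)%E.
have H (x y : itv_bound R) : \1_([set` Interval x y]) t = (t \in Interval x y)%:R :> R.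
  rewrite indicE; congr (nat_of_bool _)%:R.
  by apply/idP/idP => [/set_mem|h]; [|exact/mem_set].
rewrite !H !in_itv /=; have [ta|ta] := leP t a.
  by rewrite (le_trans ta ab) !andbT addr0.
by rewrite andbF add0r /= (le_trans a0 (ltW ta)).
Qed.

Lemma integral_indic_cst (a b : R) (c : \bar R) : a <= b -> (0 <= c)%E ->
  (\int[leb]_t ((\1_(`]a, b]%classic) t)%:E * c) = (b - a)%:E * c)%E.
Proof.
move=> ab c0; under eq_integral do rewrite muleC.
rewrite ge0_integralZl//; last first.
  by apply/measurable_EFinP; exact: measurable_indic.
rewrite integral_indic// setIT muleC; congr (_ * _)%E.
apply: (etrans (lebesgue_measure_itv _)); rewrite /= lte_fin.
by case: ltgtP ab => // -> _; rewrite subrr.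
Qed.

Definition scalec n (j : 'I_n) (s : R) (x : 'rV[R]_n) := setc x j (s * x ord0 j).

Lemma rmeas_scalec n (f : 'rV[R]_n -> R) j s : rmeas f ->
  rmeas (fun x => f (scalec j s x)).
Proof.
move=> mf; apply: rmeas_comp => //; apply: rmeas_setc.
by apply: rmeasM => //; exact: rmeas_coord.
Qed.

Lemma icube_scalec n (j : 'I_n.+1) (f : 'rV[R]_n.+1 -> R) s : 0 < s ->
  rmeas f -> (forall x, 0 <= f x) ->
  (s%:E * icube (fun x => f (scalec j s x)) =
   \int[leb]_t ((\1_(`[0%R, s]%classic) t)%:E * icube (fun y => f (ins j t y))))%E.
Proof.
move=> s0 mf f0; rewrite (icube_ins j)//; last exact: rmeas_scalec.
rewrite -integral_indic_scale//; last 2 first.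
- exact: measurable_icube_ins.
- by move=> t; exact: icube_ge0.
congr (_ * _)%E; apply: eq_integral => t _; congr (_ * _)%E.
by apply: eq_icube => y _; rewrite /scalec ins_at setc_ins.
Qed.

(** After the change of variable x_j runs over [0, s]; on the part beyond 1 the function keeps its
    value on the face, so the identity is exact. *)
Lemma icube_scale_up n (j : 'I_n.+1) (f : 'rV[R]_n.+1 -> R) s : 1 <= s ->
  rmeas f -> (forall x, 0 <= f x) ->
  (forall x t, 1 <= t -> f (setc x j t) = f (setc x j 1)) ->
  (s%:E * icube (fun x => f (scalec j s x)) =
   icube f + (s - 1)%:E * icube (fun x => f (setc x j 1%R)))%E.
Proof.
move=> s1 mf f0 fT; rewrite icube_scalec ?(lt_le_trans ltr01)//.
rewrite (@integral_indic_split _ 1 s)//; last 2 first.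
- exact: measurable_icube_ins.
- by move=> t; exact: icube_ge0.
rewrite -icube_ins//; congr (_ + _)%E.
rewrite icube_setc// -integral_indic_cst ?icube_ge0//; apply: eq_integral => t _.
rewrite indicE; case: (boolP (t \in _)) => [/set_mem|_]; last by rewrite !mul0e.
rewrite /= in_itv /= => /andP[t1 _]; congr (_ * _)%E; apply: eq_icube => y _.
by rewrite -(setc_ins j 0 t) fT ?(ltW t1)// setc_ins.
Qed.

(** Now x_j covers only [0, s]; monotonicity bounds the missing part from below by the value at x_j
    = s. *)
Lemma icube_scale_down n (j : 'I_n.+1) (f : 'rV[R]_n.+1 -> R) s : 0 < s <= 1 ->
  rmeas f -> (forall x, 0 <= f x) ->
  (forall x t t', t <= t' -> f (setc x j t) <= f (setc x j t')) ->
  (s%:E * icube (fun x => f (scalec j s x)) +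
   (1 - s)%:E * icube (fun x => f (setc x j s)) <= icube f)%E.
Proof.
move=> /andP[s0 s1] mf f0 fT; rewrite icube_scalec//.
rewrite [leRHS](icube_ins j)// (@integral_indic_split _ s 1) ?(ltW s0)//; last 2 first.
- exact: measurable_icube_ins.
- by move=> t; exact: icube_ge0.
apply: leeD2l; rewrite icube_setc// -integral_indic_cst ?icube_ge0//.
apply: integral_le_unconditional => t.
rewrite indicE; case: (boolP (t \in _)) => [/set_mem|_]; last by rewrite !mul0e.
rewrite /= in_itv /= => /andP[st _]; rewrite !mul1e; apply: le_icube => y _.
by rewrite -(setc_ins j 0 t) -(setc_ins j 0 s) fT ?(ltW st).
Qed.

Lemma bmeas_scalec n (f : 'rV[R]_n -> R) j s C : rmeas f -> (forall x, `|f x| <= C) ->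
  bmeas (fun x => f (scalec j s x)).
Proof. by move=> mf fC; split; [exact: rmeas_scalec|exists C]. Qed.

Lemma cint_scale_up n (j : 'I_n) (f : 'rV[R]_n -> R) s C : 1 <= s ->
  rmeas f -> (forall x, 0 <= f x <= C) ->
  (forall x t, 1 <= t -> f (setc x j t) = f (setc x j 1)) ->
  s * cint (fun x => f (scalec j s x)) =
   cint f + (s - 1) * cint (fun x => f (setc x j 1)).
Proof.
case: n j f => [[]//|n] j f s1 mf fC fT.
have f0 x : 0 <= f x by case/andP: (fC x).
have fC' x : `|f x| <= C by rewrite ger0_norm//; case/andP: (fC x).
have nf : bmeas f by split => //; exists C.
apply: EFin_inj; rewrite EFinD !EFinM -!icubeE//.
- exact: icube_scale_up.
- by apply: bmeas_setc => //; rewrite ler01 lexx.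
- exact: bmeas_scalec.
Qed.

Lemma cint_scale_down n (j : 'I_n) (f : 'rV[R]_n -> R) s C : 0 < s <= 1 ->
  rmeas f -> (forall x, 0 <= f x <= C) ->
  (forall x t t', t <= t' -> f (setc x j t) <= f (setc x j t')) ->
  s * cint (fun x => f (scalec j s x)) +
   (1 - s) * cint (fun x => f (setc x j s)) <= cint f.
Proof.
case: n j f => [[]//|n] j f s1 mf fC fT.
have f0 x : 0 <= f x by case/andP: (fC x).
have fC' x : `|f x| <= C by rewrite ger0_norm//; case/andP: (fC x).
have nf : bmeas f by split => //; exists C.
rewrite -lee_fin EFinD !EFinM -!icubeE//.
- exact: icube_scale_down.
- by apply: bmeas_setc => //; case/andP: s1 => [/ltW ->].
- exact: bmeas_scalec.
Qed.

End Coordinate.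

(** * Revenue as a functional of the indirect utility *)

Section Revenue.
Variable R : realType.
Local Notation leb := (@lebesgue_measure R).
Implicit Types n : nat.

(** Composing with this projection extends the indirect utility to all rows, because a scaled row
    may leave the cube. *)
Definition clamp n (x : 'rV[R]_n) : 'rV[R]_n :=
  \row_i Num.min 1 (Num.max 0 (x ord0 i)).

Lemma cube_clamp n (x : 'rV[R]_n) : cube n (clamp x).
Proof.
by move=> i; rewrite mxE ge_min lexx /= le_min ler01 le_max lexx.
Qed.

Lemma clamp_id n (x : 'rV[R]_n) : cube n x -> clamp x = x.
Proof.
by move=> cx; apply/rowP => i; rewrite mxE; have /andP[x0 x1] := cx i;
  rewrite max_r// min_r.
Qed.

Lemma clamp_lip n (x y : 'rV[R]_n) i :
  `|clamp x ord0 i - clamp y ord0 i| <= `|x ord0 i - y ord0 i|.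
Proof.
rewrite !mxE; move: (x ord0 i : R) (y ord0 i : R) => a b.
case: (leP 0 a) => ?; case: (leP 0 b) => ?; rewrite ?(min_r ler01);
  case: (leP 1 a) => ?; case: (leP 1 b) => ?;
  rewrite ler_norml; case: (ger0P (a - b)) => ?; apply/andP; split; lra.
Qed.

(** For an indirect utility the Lipschitz bound and monotonicity come from allocations in [0,1],
    nonnegativity from individual rationality, and constancy past 1 from the clamp. *)
Definition utilfun n (u : 'rV[R]_n -> R) :=
  [/\ lip1 u, exists C, forall x, 0 <= u x <= C,
      forall j x t t', t <= t' -> u (setc x j t) <= u (setc x j t') &
      forall j x t, 1 <= t -> u (setc x j t) = u (setc x j 1)].

Definition indirect n (M : mechanism R n) (x : 'rV[R]_n) :=
  utility M (clamp x) (clamp x).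

Definition Phi n (u : 'rV[R]_n -> R) :=
  \sum_(j < n) cint (fun x => u (setc x j 1)) - (n%:R + 1) * cint u.

(** Incentive compatibility as a subgradient inequality: the allocation at y is a subgradient of the
    utility there. *)
Lemma indirect_sub n (M : mechanism R n) (x y : 'rV[R]_n) : IC M ->
  indirect M y + \sum_i alloc M (clamp y) ord0 i * (clamp x ord0 i - clamp y ord0 i)
    <= indirect M x.
Proof.
move=> ic; apply: le_trans (ic _ _ (cube_clamp x) (cube_clamp y)).
rewrite /indirect /utility addrAC; apply: lerB => //.
by rewrite -big_split /=; apply: ler_sum => i _; rewrite -mulrDr addrC subrK.
Qed.

Lemma indirect_ins n (M : mechanism R n) (x : 'rV[R]_n) j t : IC M ->
  indirect M x +
    alloc M (clamp x) ord0 j * (clamp (setc x j t) ord0 j - clamp x ord0 j)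
    <= indirect M (setc x j t).
Proof.
move=> ic; apply: le_trans (indirect_sub _ x ic); rewrite lerD2l (bigD1 j)//=.
rewrite lerDl big1// => i ij.
by rewrite [clamp _ _ i]mxE [X in _ - X]mxE setc_other// subrr mulr0.
Qed.

Lemma utilfun_indirect n (M : mechanism R n) : feasible M -> IC M -> IR M ->
  utilfun (indirect M).
Proof.
move=> fe ic ir.
have a01 x i : 0 <= alloc M (clamp x) ord0 i <= 1 by exact: (fe _ (cube_clamp x)).
have lp x y : indirect M x - indirect M y <= \sum_i `|x ord0 i - y ord0 i|.
  have := indirect_sub y x ic => h.
  apply: (@le_trans _ _ (\sum_i alloc M (clamp x) ord0 i *
      (clamp x ord0 i - clamp y ord0 i))).
    rewrite (_ : \sum_i _ = - \sum_i alloc M (clamp x) ord0 i *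
      (clamp y ord0 i - clamp x ord0 i)); first by lra.
    by rewrite -sumrN; apply: eq_bigr => i _; rewrite -mulrN opprB.
  apply: ler_sum => i _; have /andP[a0 a1] := a01 x i.
  apply: le_trans (clamp_lip x y i); apply: (le_trans (ler_norm _)).
  by rewrite normrM ger0_norm// ler_piMl.
split.
- move=> x y; rewrite ler_norml lp andbT lerNl opprB.
  by under eq_bigr do rewrite distrC; exact: lp.
- exists (indirect M 0 + n%:R) => x; rewrite ir/=; last exact: cube_clamp.
  have := lp (clamp x) 0; rewrite /indirect !(clamp_id (cube_clamp _)) lerBlDl.
  move=> h; apply: (le_trans h); rewrite lerD2l.
  rewrite -[leRHS]mulr_natl mulr1 -[X in _ <= X%:R]card_ord -sumr_const.
  apply: ler_sum => i _; have /andP[c0 c1] := cube_clamp x i.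
  by rewrite [X in _ - X]mxE subr0 ger0_norm.
- move=> j x t t' tt'.
  have := @indirect_ins _ M (setc x j t) j t' ic.
  rewrite (_ : setc (setc x j t) j t' = setc x j t'); last first.
    by apply/rowP => i; rewrite !mxE; case: eqP.
  apply: le_trans; rewrite lerDl mulr_ge0//; first by case/andP: (a01 (setc x j t) j).
  rewrite subr_ge0 !mxE !eqxx le_min ge_min lexx /= ge_min ge_max !le_max lexx tt'.
  by rewrite !orbT.
- move=> j x t t1; rewrite /indirect (_ : clamp (setc x j t) = clamp (setc x j 1))//.
  apply/rowP => i; rewrite !mxE; case: eqP => // _.
  by rewrite !max_r ?ler01// ?min_l// (le_trans ler01 t1).
Qed.

Lemma utilfun_nice n (u : 'rV[R]_n -> R) : utilfun u -> bmeas u.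
Proof.
move=> [lu [C uC] _ _]; split; first exact: rmeas_lip1.
by exists C => x _; have /andP[u0 ?] := uC x; rewrite ger0_norm.
Qed.

Lemma utilfun_scalec_nice n (u : 'rV[R]_n -> R) j s : utilfun u ->
  bmeas (fun x => u (scalec j s x)).
Proof.
move=> uu; have [lu [C uC] _ _] := uu; apply: (@bmeas_scalec _ _ _ _ _ C).
  exact: rmeas_lip1.
by move=> x; have /andP[u0 ?] := uC x; rewrite ger0_norm.
Qed.

(** Volume of the slab that scaling pushes out of the cube. There the difference quotient does not
    control alloc_j * x_j, and the trivial bound 1 is charged instead. *)
Lemma cint_tail n (j : 'I_n) s : 1 <= s ->
  cint (\1_[set x : 'rV[R]_n | 1 < s * x ord0 j]) = 1 - s^-1.
Proof.
case: n j => [[]//|n] j s1.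
have s0 : 0 < s by rewrite (lt_le_trans ltr01).
have mA : rset [set x : 'rV[R]_n.+1 | 1 < s * x ord0 j].
  by apply: rset_lt => //; apply: rmeasM => //; exact: rmeas_coord.
apply: EFin_inj; rewrite -icubeE; last exact: bmeas_indic.
rewrite (icube_ins j)//; last exact: rmeas_indic.
rewrite -[RHS]mule1 -integral_indic_cst ?invf_le1//; apply: eq_integral => t _.
rewrite (_ : icube _ = (\1_[set t : R | 1 < s * t] t)%:E); last first.
  rewrite -(icube_cst n) ?indicE//; apply: eq_icube => y _.
  rewrite !indicE; congr (nat_of_bool _)%:R.
  by apply/idP/idP => /set_mem /=; rewrite ?ins_at => h; apply/mem_set; rewrite /= ?ins_at.
rewrite mule1 -EFinM !indicE -natrM mulnb; congr (nat_of_bool _)%:R%:E.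
apply/andP/idP => [[/set_mem/= + /set_mem/=]|/set_mem/=]; rewrite in_itv /=.
  move=> /andP[_ t1] st; apply/mem_set; rewrite /= in_itv /= t1 andbT.
  by rewrite -ltr_pdivrMl// mulr1 in st.
move=> /andP[st t1]; split; apply/mem_set; rewrite /= ?in_itv /=.
  by rewrite t1 andbT (le_trans _ (ltW st))// invr_ge0 ltW.
by rewrite -(ltr_pdivrMl _ _ s0) mulr1.
Qed.

Lemma face_ge n (u : 'rV[R]_n -> R) j : utilfun u ->
  cint u <= cint (fun x => u (setc x j 1)).
Proof.
move=> uu; apply: le_cint.
- exact: utilfun_nice.
- by apply: bmeas_setc; [exact: utilfun_nice|rewrite ler01 lexx].
move=> x cx; rewrite -[in leLHS](setc_id x j); have [_ _ + _] := uu; apply.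
by case/andP: (cx j).
Qed.

(* Comparing the report x with the report where x_j is scaled by s bounds
   alloc_j * x_j by a difference quotient of u, whose integral is explicit by
   the change of variable x_j := s * x_j. *)
Lemma revenue_le_scale n (M : mechanism R n) s :
  feasible M -> IC M -> IR M -> 1 < s ->
  (revenue M <= (Phi (indirect M) + n%:R * (s - 1))%:E)%E.
Proof.
move=> fe ic ir s1; have uu := utilfun_indirect fe ic ir.
set u := indirect M in uu *; have nu := utilfun_nice uu.
have s10 : 0 < s - 1 by rewrite subr_gt0.
have s0 : 0 < s by rewrite (lt_trans ltr01).
pose T j : set 'rV[R]_n := [set x | 1 < s * x ord0 j].
have nT j : bmeas (\1_(T j) : 'rV[R]_n -> R).
  apply: bmeas_indic; apply: rset_lt => //.
  by apply: rmeasM => //; exact: rmeas_coord.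
(* A bounded measurable majorant of the payment, which itself need not be measurable. *)
pose q x := \sum_(j < n) ((s - 1)^-1 * (u (scalec j s x) - u x) + \1_(T j) x) - u x.
have nq1 j : bmeas (fun x => (s - 1)^-1 * (u (scalec j s x) - u x)).
  by apply: bmeasZ; apply: bmeasB => //; exact: utilfun_scalec_nice.
have nq j : bmeas (fun x => (s - 1)^-1 * (u (scalec j s x) - u x) + \1_(T j) x).
  by apply: bmeasD.
have nqq : bmeas q by apply: bmeasB => //; exact: bmeas_sum.
apply: (@le_trans _ _ (icube q)).
  apply: le_icube => x cx.
  have -> : pay M x = \sum_i alloc M x ord0 i * x ord0 i - u x.
    by rewrite /u /indirect clamp_id// /utility opprB addrC subrK.
  apply: lerB => //; apply: ler_sum => j _.
  have /andP[a0 a1] := fe _ cx j; have /andP[x0 x1] := cx j.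
  have := @indirect_ins _ M x j (s * x ord0 j) ic; rewrite clamp_id//.
  rewrite mxE setc_at -/u -/(scalec j s x) indicE => h.
  case: (boolP (x \in T j)) => [_|/negP xT].
    rewrite ler_wpDl// ?mulr_ile1//; apply: mulr_ge0; first by rewrite invr_ge0 ltW.
    rewrite subr_ge0 -[in leLHS](setc_id x j); have [_ _ + _] := uu; apply.
    by rewrite ler_peMl// ltW.
  rewrite addr0 ler_pdivlMl//; move: h.
  have sx1 : s * x ord0 j <= 1 by rewrite leNgt; apply/negP => h; apply: xT; exact/mem_set.
  by rewrite max_r ?mulr_ge0 ?(ltW s0)// min_r//; lra.
rewrite icubeE// lee_fin /q cintB//; last exact: bmeas_sum.
rewrite cint_sum// /Phi.
have e j : cint (fun x => (s - 1)^-1 * (u (scalec j s x) - u x) + \1_(T j) x) <=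
    cint (fun x => u (setc x j 1)) - cint u + (s - 1).
  have ns := utilfun_scalec_nice j s uu.
  rewrite (cintD (nq1 j) (nT j)) cintZ; last exact: bmeasB.
  rewrite (cintB ns nu).
  have -> : cint (\1_(T j)) = 1 - s^-1 by exact: cint_tail (ltW s1).
  have [lu [C uC] _ uT] := uu.
  have := cint_scale_up (ltW s1) (rmeas_lip1 lu) uC (uT j).
  have := face_ge j uu; set F := cint (fun x => u (setc x j 1)); set I := cint u.
  set S := cint _ => FI sS.
  have -> : S = (I + (s - 1) * F) / s by rewrite -sS mulrC mulKf ?gt_eqF.
  have -> : (s - 1)^-1 * ((I + (s - 1) * F) / s - I) = (F - I) / s.
    by field; rewrite !gt_eqF.
  apply: lerD; first by rewrite ler_pdivrMr// ler_peMr ?subr_ge0// ltW.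
  rewrite -subr_ge0 (_ : _ - _ = (s - 1) ^+ 2 / s); last by field; rewrite gt_eqF.
  by rewrite divr_ge0 ?sqr_ge0// ltW.
apply: (@le_trans _ _ (\sum_(j < n) (cint (fun x => u (setc x j 1)) - cint u + (s - 1)) - cint u)).
  by apply: lerB => //; exact: ler_sum.
have sumc (a : R) : \sum_(j < n) a = n%:R * a by rewrite sumr_const card_ord mulr_natl.
rewrite !big_split /= !sumc; lra.
Qed.

(** The counterpart with s < 1. The scaled report stays in the cube, so no slab appears, but the
    change of variable yields the section x_j = s; the Lipschitz bound moves it to the face x_j = 1
    at cost 1 - s. *)
Lemma revenue_ge_scale n (M : mechanism R n) s :
  feasible M -> IC M -> IR M -> 0 < s < 1 ->
  ((Phi (indirect M) - n%:R * ((1 - s) / s))%:E <= revenue M)%E.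
Proof.
move=> fe ic ir /andP[s0 s1]; have uu := utilfun_indirect fe ic ir.
set u := indirect M in uu *; have nu := utilfun_nice uu.
have s10 : 0 < 1 - s by rewrite subr_gt0.
pose q x := \sum_(j < n) ((1 - s)^-1 * (u x - u (scalec j s x))) - u x.
have nq j : bmeas (fun x => (1 - s)^-1 * (u x - u (scalec j s x))).
  by apply: bmeasZ; apply: bmeasB => //; exact: utilfun_scalec_nice.
have nqq : bmeas q by apply: bmeasB => //; exact: bmeas_sum.
apply: (@le_trans _ _ (icube q)); last first.
  apply: le_icube => x cx.
  have -> : pay M x = \sum_i alloc M x ord0 i * x ord0 i - u x.
    by rewrite /u /indirect clamp_id// /utility opprB addrC subrK.
  apply: lerB => //; apply: ler_sum => j _.
  have /andP[x0 x1] := cx j.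
  have := @indirect_ins _ M x j (s * x ord0 j) ic; rewrite clamp_id//.
  rewrite mxE setc_at -/u -/(scalec j s x) ler_pdivrMl//.
  have sx1 : s * x ord0 j <= 1 by rewrite mulr_ile1// ltW.
  by rewrite max_r ?mulr_ge0 ?(ltW s0)// min_r//; lra.
rewrite icubeE// lee_fin /q cintB//; last exact: bmeas_sum.
rewrite cint_sum// /Phi.
have e j : cint (fun x => u (setc x j 1)) - cint u - (1 - s) / s <=
    cint (fun x => (1 - s)^-1 * (u x - u (scalec j s x))).
  have ns := utilfun_scalec_nice j s uu.
  rewrite cintZ; last exact: bmeasB.
  rewrite (cintB nu ns).
  have [lu [C uC] um _] := uu.
  have s01 : 0 < s <= 1 by rewrite s0 ltW.
  have := cint_scale_down s01 (rmeas_lip1 lu) uC (um j).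
  have : cint (fun x => u (setc x j 1)) - (1 - s) <= cint (fun x => u (setc x j s)).
    have nst t : 0 <= t <= 1 -> bmeas (fun x => u (setc x j t)).
      by move=> t01; exact: (bmeas_setc j nu).
    rewrite -(cint_cst n (1 - s)) -(cintB (nst 1 _) (@bmeas_cst R n _)); last first.
      by rewrite ler01 lexx.
    apply: le_cint => [||x cx].
    - by apply: bmeasB; [apply: nst; rewrite ler01 lexx|exact: bmeas_cst].
    - by apply: nst; rewrite !ltW.
    have := lu (setc x j 1) (setc x j s); rewrite (bigD1 j)//= big1 ?addr0; last first.
      by move=> i ij; rewrite !setc_other// subrr normr0.
    by rewrite !setc_at (ger0_norm (ltW s10)) ler_norml => /andP[_]; lra.
  have := face_ge j uu; set F := cint (fun x => u (setc x j 1)); set I := cint u.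
  set W := cint (fun x => u (setc x j s)); set S := cint _ => FI FW SI.
  rewrite ler_pdivlMl// -(ler_pM2r s0).
  rewrite (_ : _ * s = (1 - s) * (s * (F - I) - (1 - s))); last by field; rewrite gt_eqF.
  have : (1 - s) * (F - (1 - s)) <= (1 - s) * W by rewrite ler_pM2l.
  have : (1 - s) * (s * (F - I)) <= (1 - s) * (F - I).
    by rewrite ler_pM2l// ler_piMl ?subr_ge0// ltW.
  lra.
apply: (@le_trans _ _ (\sum_(j < n) (cint (fun x => u (setc x j 1)) - cint u - (1 - s) / s) - cint u)); last first.
  by apply: lerB => //; exact: ler_sum.
have sumc (a : R) : \sum_(j < n) a = n%:R * a by rewrite sumr_const card_ord mulr_natl.
rewrite !big_split /= !sumc; lra.
Qed.

Lemma revenueE n (M : mechanism R n) : feasible M -> IC M -> IR M ->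
  revenue M = (Phi (indirect M))%:E.
Proof.
move=> fe ic ir; apply/eqP; rewrite eq_le; apply/andP; split.
  apply/lee_addgt0Pr => e e0; rewrite -EFinD.
  have d0 : 0 < e / (n%:R + 1) by rewrite divr_gt0// ltr_wpDl.
  apply: (le_trans (@revenue_le_scale _ M (1 + e / (n%:R + 1)) fe ic ir _)).
    by rewrite ltrDl.
  rewrite lee_fin lerD2l [1 + _]addrC addrK mulrCA ger_pMr//.
  by rewrite ler_pdivrMr ?ltr_wpDl// mul1r lerDl.
apply/lee_addgt0Pr => e e0; rewrite -leeBlDr// -EFinB.
set d := e / (n%:R + 1); have d0 : 0 < d by rewrite divr_gt0// ltr_wpDl.
(* For s = 1 / (1 + d) the error term (1 - s) / s is exactly d. *)
apply: le_trans (@revenue_ge_scale _ M (1 + d)^-1 fe ic ir _); last first.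
  by rewrite invr_gt0 invf_lt1 ltr_wpDl ?ltr01 ?ler01//= ltrDl.
rewrite lee_fin lerD2l lerN2 (_ : _ / _ = d); last first.
  by field; rewrite gt_eqF// addr_gt0.
by rewrite /d mulrCA ger_pMr// ler_pdivrMr ?ltr_wpDl// mul1r lerDl.
Qed.

End Revenue.

(** * From nonpositive deficiency to an inequality between volume and faces *)

Section Deficiency.
Variable R : realType.
Implicit Types n : nat.

Lemma rmeas_row n p (g : 'rV[R]_n -> 'I_p -> R) :
  (forall i, rmeas (fun x => g x i)) ->
  forall i, rmeas (fun x => (\row_i g x i) ord0 i).
Proof. by move=> mg i; under eq_fun do rewrite mxE; exact: mg. Qed.

Lemma rmeas_coord_affine n (a b : R) (i : 'I_n) :
  rmeas (fun x : 'rV[R]_n => a * x ord0 i + b).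
Proof. by apply: rmeasD => //; apply: rmeasM => //; exact: rmeas_coord. Qed.

Lemma iint_indic_cube n (A : set 'rV[R]_n) : A `<=` cube n ->
  vol A = icube (\1_A : 'rV[R]_n -> R).
Proof.
move=> Ac; apply: eq_iint => x; congr EFin; rewrite !indicE.
case: (boolP (x \in A)) => [/set_mem/Ac cx|_]; last by rewrite mulr0.
by rewrite mem_set// mulr1.
Qed.

Lemma compact_cube_sub n (D : set 'rV[R]_n) c : 0 <= c -> closed D ->
  (forall y, D y -> forall i, 0 <= y ord0 i <= c) -> compact D.
Proof.
move=> c0 clD Dc; apply: bounded_closed_compact => //.
exists c; split; first exact: num_real.
move=> M cM y /Dc yc /=; rewrite [leLHS]/Num.norm /= mx_normrE; apply/bigmax_leP.
split=> [|[i j] _ /=]; first exact: le_trans c0 (ltW cM).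
rewrite (ord1 i); have /andP[y0 y1] := yc j.
by rewrite ger0_norm// (le_trans y1)// ltW.
Qed.

Lemma continuous_row_lip n p (K : R) (g : 'rV[R]_n -> 'rV[R]_p) : 0 <= K ->
  (forall x y i, `|g x ord0 i - g y ord0 i| <= K * \sum_j `|x ord0 j - y ord0 j|) ->
  continuous g.
Proof.
move=> K0 gK x /= B /nbhs_ballP[e /= e0 eB].
have d0 : 0 < K * n%:R + 1 by rewrite ltr_wpDl// mulr_ge0.
apply/nbhs_ballP; exists (e / (K * n%:R + 1)) => /=; first by rewrite divr_gt0.
move=> y [_ xy]; apply: eB; split=> // a i; rewrite (ord1 a) -ball_normE /=.
apply: (le_lt_trans (gK _ _ _)).
apply: (@le_lt_trans _ _ (K * (n%:R * (e / (K * n%:R + 1))))).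
  apply: ler_wpM2l => //.
  rewrite mulr_natl -[X in _ *+ X]card_ord -sumr_const; apply: ler_sum => j _.
  by have := xy ord0 j; rewrite -ball_normE /= => /ltW.
by rewrite !mulrA -mulrA mulrCA gtr_pMr// ltr_pdivrMr ?mul1r ?ltrDl.
Qed.

Lemma continuous_row_affine n (a b : R) :
  continuous (fun y : 'rV[R]_n => \row_i (a * y ord0 i + b)).
Proof.
apply: (@continuous_row_lip _ _ `|a|) => // x y i.
rewrite !mxE opprD addrACA subrr addr0 -mulrBr normrM ler_wpM2l//.
by rewrite (bigD1 i)//= lerDl sumr_ge0.
Qed.

(* Reflection and dilation turn the bodies of the SIM-body into
   subsets of the cube stable under raising a coordinate to 1; the projection
   along coordinate i becomes the face x_i = 1. *)
Lemma slice_deficiency r (c : R) (A : set 'rV[R]_r) : (0 < r)%N -> 0 < c ->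
  A `<=` cube r -> closed A -> rset A ->
  (forall x i, A x -> A (setc x i 1)) ->
  (forall D : set 'rV[R]_r, body D ->
    (forall y, D y -> exists2 x, A x & forall i, y ord0 i = c * (1 - x ord0 i)) ->
    ~ (0 < deficiency 1 D)%E) ->
  cint (\1_A) <= cint (fun x => c^-1 * \sum_i \1_A (setc x i 1)).
Proof.
case: r A => // r A _ c0 Ac clA mA A1 noD.
have cN0 : c != 0 by rewrite gt_eqF.
pose phi n (y : 'rV[R]_n) : 'rV[R]_n := \row_i (- c^-1 * y ord0 i + 1).
pose psi n (x : 'rV[R]_n) : 'rV[R]_n := \row_i (- c * x ord0 i + c).
have phiK n : cancel (@psi n) (@phi n).
  by move=> x; apply/rowP => i; rewrite !mxE; field.
have mphi n i : rmeas (fun y : 'rV[R]_n => phi n y ord0 i).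
  by apply: rmeas_row => k; exact: rmeas_coord_affine.
have volphi n (B : set 'rV[R]_n) : rset B -> B `<=` cube n ->
    vol (@phi n @^-1` B) = (c ^+ n * cint (\1_B))%:E.
  move=> mB Bc; rewrite /vol (@iint_affine _ n (- c) c) ?oppr_eq0//; last first.
  - by apply: rmeas_EFin; apply: rmeas_indic; exact: rset_comp.
  rewrite normrN gtr0_norm// EFinM -icubeE; last exact: bmeas_indic.
  rewrite -iint_indic_cube//; congr (_ * _)%E; apply: eq_iint => x.
  by rewrite -[\row_i _]/(psi n x) indicE -[_ \in _]/(phi n (psi n x) \in B) phiK -indicE.
pose D := @phi r.+1 @^-1` A.
(* The value y_i = 0 corresponds to x_i = 1. A projected point is moved to that face by [A1];
   conversely a point of the face is lifted by inserting 0 at i. *)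
have DE i : proj_out i D = @phi r @^-1` [set w | A (ins i 1 w)].
  have insE w : phi r.+1 (ins i 0 w) = ins i 1 (phi r w).
    apply/rowP => k; rewrite mxE; case: (unliftP i k) => [l ->|->].
      by rewrite !ins_lift mxE.
    by rewrite !ins_at mulr0 add0r.
  apply/seteqP; split=> [w [y Dy <-]|w /= Aw].
    rewrite /= -insE (_ : phi _ _ = setc (phi r.+1 y) i 1); first exact: A1.
    apply/rowP => k; rewrite mxE; case: (unliftP i k) => [l ->|->].
      by rewrite ins_lift !mxE eq_sym (negbTE (neq_lift _ _)).
    by rewrite ins_at setc_at mulr0 add0r.
  exists (ins i 0 w); first by rewrite /D /= insE.
  by apply/rowP => k; rewrite mxE ins_lift.
have Dle : (vol D <= \sum_(i < r.+1) vol (proj_out i D))%E.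
  have volD : vol D = (c ^+ r.+1 * cint (\1_A))%:E by exact: volphi.
  rewrite leNgt; apply/negP => lt; apply: (noD D).
  - have Dc y : D y -> forall i, 0 <= y ord0 i <= c.
      move=> /Ac cy i; have := cy i; rewrite mxE => /andP[h1 h2].
      rewrite -(ler_pM2l (_ : 0 < c^-1)) ?invr_gt0// mulr0.
      by rewrite -(ler_pM2l (_ : 0 < c^-1) (y ord0 i)) ?invr_gt0// mulVf//; apply/andP; split; lra.
    split; last by move=> x /Dc h i; case/andP: (h i).
    apply: (compact_cube_sub (ltW c0)) => //.
    apply: closed_comp => // y _; exact: continuous_row_affine.
  - move=> y Dy; exists (phi _ y) => // i; rewrite mxE; field; exact: cN0.
  - rewrite /deficiency mul1e sube_gt0//.
(* The volume carries c^(r+1) and each projection only c^r; the quotient is the factor c^-1 of the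
   conclusion. *)
rewrite -(ler_pM2l (exprn_gt0 r.+1 c0)) -lee_fin.
rewrite -volphi//; apply: (le_trans Dle).
have m1 i : rset [set w | A (ins i 1 w)].
  move=> d S x mx; apply: (mA _ _ (fun s => ins i 1 (x s))).
  exact: mrow_ins.
have F i : cint (fun x => \1_A (setc x i 1)) = cint (\1_[set w | A (ins i 1 w)] : 'rV[R]_r -> R).
  rewrite /cint icube_setc; [|exact: rmeas_indic|by move=> x; rewrite indicE].
  by congr fine; apply: eq_icube => w _; rewrite !indicE.
have nF (i : 'I_r.+1) : bmeas (fun x => \1_A (setc x i 1) : R).
  by apply: bmeas_setc; [exact: bmeas_indic|rewrite ler01 lexx].
rewrite cintZ; last exact: bmeas_sum.
rewrite cint_sum// exprSr -mulrA mulVKf// mulr_sumr -sumEFin.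
apply: lee_sum => i _; rewrite DE volphi ?F//.
by move=> w /= /Ac /cube_ins[].
Qed.

(** Needed since [#|~: J| + #|J|] equals m only propositionally. *)
Lemma iint_reindex_cast n m (e : n = m) (s : 'I_m -> 'I_n) (f : 'rV[R]_m -> \bar R) :
  injective s -> (forall x, (0 <= f x)%E) -> rmeas f ->
  iint (fun x : 'rV[R]_n => f (\row_i x ord0 (s i))) = iint f.
Proof. by case: m / e s f => s f; exact: iint_reindex. Qed.

(** Places the coordinates of J in the last block, so that [iint_split] makes the slice over J the
    inner integral. The map is the inverse of the concatenated enumerations of the complement and of
    J. *)
Lemma split_coordinates m (J : {set 'I_m}) :
  exists s : 'I_m -> 'I_(#|~: J| + #|J|),
    injective s /\ (forall b : 'I_#|J|, s (enum_val b) = rshift _ b).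
Proof.
pose t (k : 'I_(#|~: J| + #|J|)) : 'I_m :=
  match fintype.split k with inl a => enum_val a | inr b => enum_val b end.
have tI : injective t.
  move=> k l; rewrite /t -{2}(splitK k) -{2}(splitK l).
  case: (fintype.split k) => a; case: (fintype.split l) => b /=.
  - by move=> /enum_val_inj ->.
  - by move=> h; have := enum_valP a; rewrite h inE enum_valP.
  - by move=> h; have := enum_valP b; rewrite -h inE enum_valP.
  - by move=> /enum_val_inj ->.
have [s tK sK] : bijective t.
  apply: inj_card_bij => //; rewrite !card_ord.
  by rewrite addnC cardsC card_ord.
exists s; split=> [|b]; first exact: can_inj sK.
rewrite -[RHS]tK; congr s; rewrite /t.
by rewrite -[rshift _ b]/(unsplit (inr b)) unsplitK.
Qed.

(** Freeze the coordinates z outside J, apply [slice_deficiency] to the slice [Az z], and integrate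
    over z. *)
Lemma deficiency_le m (c : R) (J : {set 'I_m}) (A : set 'rV[R]_m) :
  (0 < #|J|)%N -> 0 < c ->
  A `<=` cube m -> closed A -> rset A ->
  (forall x j, j \in J -> A x -> A (setc x j 1)) ->
  (forall D : set 'rV[R]_#|J|, body D ->
    (forall y, D y -> exists2 x, A x &
       forall b : 'I_#|J|, y ord0 b = c * (1 - x ord0 (enum_val b))) ->
    ~ (0 < deficiency 1 D)%E) ->
  cint (\1_A) <= cint (fun x => c^-1 * \sum_(j in J) \1_A (setc x j 1)).
Proof.
move=> J0 c0 Ac clA mA A1 noD.
have [s [sI sE]] := split_coordinates J.
pose mrg (z : 'rV[R]_#|~: J|) (y : 'rV[R]_#|J|) : 'rV[R]_m :=
  \row_i (row_mx z y) ord0 (s i).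
pose H (x : 'rV[R]_m) : R := c^-1 * \sum_(j in J) \1_A (setc x j 1).
have nH : bmeas H.
  apply: bmeasZ; apply: bmeas_sum => j.
  by apply: (bmeas_setc j (bmeas_indic mA)); rewrite ler01 lexx.
have H0 x : 0 <= H x.
  by rewrite mulr_ge0 ?invr_ge0 ?(ltW c0)// sumr_ge0// => j _; rewrite indicE.
have e : (#|~: J| + #|J| = m)%N by rewrite addnC cardsC card_ord.
have mrgE (f : 'rV[R]_m -> \bar R) : (forall x, (0 <= f x)%E) -> rmeas f ->
    iint f = iint (fun z => iint (fun y => f (mrg z y))).
  by move=> f0 mf; rewrite -(iint_reindex_cast e sI)// iint_split.
have mrgP i : (exists b, i = enum_val b /\ forall z y, mrg z y ord0 i = y ord0 b) \/
    (i \notin J /\ exists a, forall z y, mrg z y ord0 i = z ord0 a).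
  case: (boolP (i \in J)) => [iJ|iJ]; [left|right].
    exists (enum_rank_in iJ i); rewrite enum_rankK_in//; split=> // z y.
    by rewrite mxE -{1}(enum_rankK_in iJ iJ) sE row_mxEr.
  split=> //; case E : (fintype.split (s i)) => [a|b].
    by exists a => z y; rewrite mxE -(splitK (s i)) E row_mxEl.
  have := splitK (s i); rewrite E /= -sE => /sI ib.
  by move: iJ; rewrite -ib enum_valP.
have mrg_val z y b : mrg z y ord0 (enum_val b) = y ord0 b.
  by rewrite mxE sE row_mxEr.
have mrg_set z y b t : mrg z (setc y b t) = setc (mrg z y) (enum_val b) t.
  apply/rowP => i; case: (mrgP i) => [[b' [-> h]]|[iJ [a h]]].
    rewrite h; have [->|bb'] := eqVneq b' b; first by rewrite !setc_at.
    by rewrite !setc_other ?h// (inj_eq enum_val_inj).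
  rewrite setc_other ?h//; apply: contraNneq iJ => ->; exact: enum_valP.
pose Az z : set 'rV[R]_#|J| := [set y | A (mrg z y)].
have HE z y : H (mrg z y) = c^-1 * \sum_b \1_(Az z) (setc y b 1).
  rewrite /H big_enum_val; congr (_ * _); apply: eq_bigr => b _.
  by rewrite -mrg_set !indicE.
have mmrg z0 i : rmeas (fun y => mrg z0 y ord0 i).
  case: (mrgP i) => [[b [_ h]]|[_ [a h]]]; under eq_fun do rewrite h.
    exact: rmeas_coord.
  exact: rmeas_cst.
have mAz z : rset (Az z) by exact: (rset_comp mA (mmrg z)).
have key z : cint (\1_(Az z)) <= cint (fun y => H (mrg z y)).
  under [X in _ <= cint X]eq_fun do rewrite HE.
  apply: slice_deficiency => //.
  - by move=> y /Ac cy b; rewrite -(mrg_val z); exact: cy.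
  - apply: closed_comp => // y _; apply: (@continuous_row_lip _ _ 1) => // x x' i.
    rewrite mul1r; case: (mrgP i) => [[b [_ h]]|[_ [a h]]]; rewrite !h.
      by rewrite (bigD1 b)//= lerDl sumr_ge0.
    by rewrite subrr normr0 sumr_ge0.
  - by move=> y b; rewrite /Az /= mrg_set; apply: A1; exact: enum_valP.
  - move=> D bD h; apply: noD => // y /h[x Ax xy].
    by exists (mrg z x) => // b; rewrite mrg_val.
rewrite -lee_fin -!icubeE//; last exact: bmeas_indic.
rewrite /icube mrgE; last 2 first.
- by move=> x; rewrite lee_fin mulr_ge0.
- by apply: rmeas_icube; exact: rmeas_indic.
rewrite [leRHS]mrgE; last 2 first.
- move=> x; rewrite lee_fin; apply: mulr_ge0; first exact: indic_cube01.
  exact: H0.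
- by apply: rmeas_icube; case: nH.
apply: iint_le => z.
rewrite (_ : iint _ = icube (\1_(Az z) : _ -> R)); last first.
  apply: eq_iint => y; congr EFin; rewrite !indicE.
  rewrite (_ : (y \in Az z) = (mrg z y \in A)); last by apply/idP/idP => /set_mem/mem_set.
  case: (boolP (mrg z y \in A)) => [/set_mem/Ac cy|_]; last by rewrite !mulr0.
  by rewrite !mem_set// => b; rewrite -(mrg_val z).
rewrite (_ : iint _ = icube (fun y => H (mrg z y))); last first.
  apply: eq_iint => y; congr EFin.
  (* The indicators of the m-cube and of the cube in y can differ only if z leaves its own cube;
     then no raised point lies in A and H vanishes. *)
  have [[j [jJ Aj]]|noj] := pselect (exists j, j \in J /\ A (setc (mrg z y) j 1)).
    congr (_ * _); rewrite !indicE; congr (nat_of_bool _)%:R.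
    apply/idP/idP => /set_mem cy; apply/mem_set => i.
      by rewrite -(mrg_val z).
    case: (mrgP i) => [[b [_ ->]]|[iJ [a h]]]; first exact: cy.
    have := Ac _ Aj i; rewrite setc_other//; apply: contraNneq iJ => ->; exact: jJ.
  have Hz : H (mrg z y) = 0; last by rewrite -/(H (mrg z y)) Hz !mulr0.
  rewrite /H big1 ?mulr0// => j jJ.
  have nA : ~ A (setc (mrg z y) j 1) by move=> Aj; apply: noj; exists j.
  by rewrite indicE (memNset nA).
rewrite !icubeE ?lee_fin//; last exact: bmeas_indic.
split; first by apply: rmeas_comp => //; case: nH.
exists (c^-1 * #|J|%:R) => y _; rewrite ger0_norm// ler_wpM2l ?invr_ge0 ?(ltW c0)//.
rewrite -sum1_card natr_sum; apply: ler_sum => j _.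
by rewrite indicE; case: (_ \in _).
Qed.

End Deficiency.

(** * Hyperplanes are null sets *)

Section Hyperplane.
Variable R : realType.
Local Notation leb := (@lebesgue_measure R).

Lemma rset_hyperplane n (a : 'I_n -> R) b :
  rset [set x : 'rV[R]_n | \sum_i a i * x ord0 i = b].
Proof.
have ml : rmeas (fun x : 'rV[R]_n => \sum_i a i * x ord0 i).
  by apply: rmeas_sum => i; apply: rmeasM => //; exact: rmeas_coord.
have -> : [set x : 'rV[R]_n | \sum_i a i * x ord0 i = b] =
    [set x | \sum_i a i * x ord0 i <= b] `&` [set x | b <= \sum_i a i * x ord0 i].
  apply/seteqP; split=> x /=; first by move=> ->.
  by move=> [h1 h2]; apply/eqP; rewrite eq_le h1 h2.
by apply: rsetI; exact: rset_le.
Qed.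

(** If a coefficient after the first is nonzero, every slice is a hyperplane of lower dimension.
    Otherwise the first one is nonzero and the hyperplane fixes t = b / a_0, a null set of
    parameters. *)
Lemma icube_hyperplane n (a : 'I_n -> R) b : (exists i, a i != 0) ->
  icube (\1_[set x : 'rV[R]_n | \sum_i a i * x ord0 i = b] : 'rV[R]_n -> R) = 0%E.
Proof.
elim: n a b => [|n IH] a b [i ai]; first by case: i ai.
rewrite (icube_ins ord0); last 2 first.
- by apply: rmeas_indic; exact: rset_hyperplane.
- by move=> x; rewrite indicE.
have sumE t (y : 'rV[R]_n) : \sum_i a i * ins ord0 t y ord0 i =
    a ord0 * t + \sum_k a (lift ord0 k) * y ord0 k.
  by rewrite big_ord_recl ins_at; congr (_ + _); apply: eq_bigr => k _; rewrite ins_lift.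
have [hk|nok] := pselect (exists k, a (lift ord0 k) != 0).
  apply: integral0_eq => t _.
  rewrite (_ : icube _ = 0%E) ?mule0// -[RHS](IH _ (b - a ord0 * t) hk).
  apply: eq_icube => y _; rewrite !indicE; congr (nat_of_bool _)%:R.
  apply/idP/idP => /set_mem /= h; apply/mem_set => /=.
    by rewrite -h sumE addrC addKr.
  by rewrite sumE h addrC subrK.
have a'0 k : a (lift ord0 k) = 0.
  by apply/eqP/negPn/negP => h; apply: nok; exists k.
have a0 : a ord0 != 0.
  by move: ai; case: (unliftP ord0 i) => [k ->|->//]; rewrite a'0 eqxx.
apply/eqP; rewrite eq_le; apply/andP; split; last first.
  apply: integral_ge0 => t _; rewrite mule_ge0 ?lee_fin ?indicE//.
  by apply: icube_ge0 => y; rewrite indicE.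
apply: (@le_trans _ _ (\int[leb]_t (\1_[set b / a ord0] t)%:E)%E); last first.
  by rewrite integral_indic// setIT (_ : _ [set _] = 0%E)//; exact: lebesgue_measure_set1.
apply: integral_le_unconditional => t; rewrite indicE.
case: (boolP (t \in _)) => [_|_]; last first.
  by rewrite mul0e lee_fin indicE.
rewrite mul1e -(@icube_cst _ n) ?indicE//; apply: le_icube => y _.
rewrite indicE ler_nat; case: (boolP (_ \in _)) => //= /set_mem /= h.
rewrite mem_set//= -h sumE big1 ?addr0 1?mulrC ?mulKf// => k _.
by rewrite a'0 mul0r.
Qed.

End Hyperplane.

(** * A discrete layer cake inequality *)

Section LayerCake.
Variable R : realType.

(** A Riemann sum of mesh d for v as the integral over t >= 0 of the indicator of t < v, cut off at
    N * d. *)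
Lemma step_approx (d v : R) N : 0 < d -> 0 <= v ->
  Num.min v (N%:R * d) <= d * \sum_(i < N) (i%:R * d < v)%R%:R <= v + d.
Proof.
move=> d0 v0.
have le_card k : \sum_(i < k) (i%:R * d < v)%R%:R <= k%:R :> R.
  rewrite -[X in _ <= X%:R]card_ord -sum1_card natr_sum; apply: ler_sum => i _.
  by case: (_ < _).
elim: N => [|N /andP[IH1 IH2]].
  by rewrite big_ord0 mulr0 mul0r ge_min lexx orbT addr_ge0// ltW.
rewrite big_ord_recr /= mulrDr; have [vN|vN] := ltP (N%:R * d) v.
  move: IH1; rewrite mulr1 min_r ?(ltW vN)// => IH1; apply/andP; split.
    by rewrite ge_min; apply/orP; right; rewrite -natr1 mulrDl mul1r lerD2r.
  rewrite lerD2r; apply: le_trans (ltW vN).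
  by rewrite mulrC ler_wpM2r ?(ltW d0)//; exact: le_card.
move: IH1; rewrite mulr0 addr0 min_l// => IH1; rewrite IH2 andbT.
by apply: le_trans IH1; rewrite ge_min lexx.
Qed.

(** Both sides are decomposed along the superlevel sets 1 - [h <= t]. At each level the constants 1
    on the n faces are paid for by n <= c * cint w, and the sublevel parts are compared by the last
    hypothesis. Finite sums over t make linearity of [cint] sufficient. *)
Lemma layer_cake n (h w : 'rV[R]_n -> R) (c : R) C : 0 < c -> bmeas h -> bmeas w ->
  (forall x, cube n x -> 0 <= h x <= C) ->
  (forall x, cube n x -> 0 <= w x <= 1) ->
  n%:R <= c * cint w ->
  (forall t, cint (fun x => w x * \1_[set x | h x <= t] x) <=
     c^-1 * \sum_(j < n) cint (fun x => \1_[set x | h x <= t] (setc x j 1))) ->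
  \sum_(j < n) cint (fun x => h (setc x j 1)) <= c * cint (fun x => w x * h x).
Proof.
move=> c0 nh nw hC w01 wn lev.
have nle t : bmeas (\1_[set x | h x <= t] : 'rV[R]_n -> R).
  by apply: bmeas_indic; apply: rset_le => //; case: nh.
have i01 : 0 <= (1 : R) <= 1 by rewrite ler01 lexx.
apply/ler_addgt0Pr => e e0; pose d := e / c.
have d0 : 0 < d by rewrite divr_gt0.
have C0 : 0 <= C.
  have cz : cube n (const_mx 0 : 'rV[R]_n) by move=> i; rewrite mxE lexx ler01.
  by have /andP[] := hC _ cz; exact: le_trans.
pose N := Num.bound (C / d).
have CN : C <= N%:R * d.
  by rewrite -ler_pdivrMr// ltW// archi_boundP// divr_ge0// ltW.
pose s x : R := d * \sum_(i < N) (1 - \1_[set x | h x <= i%:R * d] x).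
have ns1 (i : 'I_N) : bmeas (fun x => 1 - \1_[set x | h x <= i%:R * d] x : R).
  by apply: bmeasB => //; exact: bmeas_cst.
have ns : bmeas s by apply: bmeasZ; exact: bmeas_sum.
have sE x : s x = d * \sum_(i < N) (i%:R * d < h x)%R%:R.
  congr (_ * _); apply: eq_bigr => i _; rewrite indicE ltNge.
  rewrite (_ : (x \in _) = (h x <= i%:R * d)); last by apply/idP/idP => [/set_mem|/mem_set].
  by case: (_ <= _); rewrite ?subrr ?subr0.
have hs x : cube n x -> h x <= s x <= h x + d.
  move=> cx; have /andP[h0 h1] := hC x cx; rewrite sE.
  by have := @step_approx d (h x) N d0 h0; rewrite min_l// (le_trans h1).
have nf (f : 'rV[R]_n -> R) j : bmeas f -> bmeas (fun x => f (setc x j 1)).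
  by move=> nf; exact: bmeas_setc.
apply: (@le_trans _ _ (\sum_(j < n) cint (fun x => s (setc x j 1)))).
  apply: ler_sum => j _; apply: le_cint; [exact: nf|exact: nf|move=> x cx].
  by have /andP[] := hs (setc x j 1) (cube_setc j cx i01).
have F j : cint (fun x => s (setc x j 1)) =
    d * \sum_(i < N) (1 - cint (fun x => \1_[set x | h x <= i%:R * d] (setc x j 1))).
  rewrite cintZ; last by apply: bmeas_sum => i; exact: nf (ns1 i).
  rewrite cint_sum; last by move=> i; exact: nf (ns1 i).
  congr (_ * _); apply: eq_bigr => i _.
  by rewrite (cintB (@bmeas_cst _ _ 1) (nf _ j (nle _))) cint_cst.
under eq_bigr do rewrite F.
rewrite -mulr_sumr exchange_big /=.
apply: (@le_trans _ _ (c * cint (fun x => w x * s x))); last first.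
  rewrite -ler_pdivlMl// mulrDr mulKf ?gt_eqF// [c^-1 * e]mulrC -/d.
  rewrite -[X in _ + X](cint_cst n d) -cintD; [|exact: bmeasM|exact: bmeas_cst].
  apply: le_cint; [exact: bmeasM|by apply: bmeasD; [exact: bmeasM|exact: bmeas_cst]|].
  move=> x cx; have /andP[w0 w1] := w01 x cx; have /andP[h1 h2] := hs x cx.
  apply: (@le_trans _ _ (w x * (h x + d))); first exact: ler_wpM2l.
  by rewrite mulrDr lerD2l ler_piMl// ltW.
have -> : cint (fun x => w x * s x) =
    d * \sum_(i < N) (cint w - cint (fun x => w x * \1_[set x | h x <= i%:R * d] x)).
  rewrite (@eq_cint _ _ _ (fun x => d * \sum_(i < N)
     (w x - w x * \1_[set x | h x <= i%:R * d] x))); last first.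
    move=> x _; rewrite /s mulrCA mulr_sumr; congr (_ * _).
    by apply: eq_bigr => i _; rewrite mulrBr mulr1.
  have nB (i : 'I_N) : bmeas (fun x => w x - w x * \1_[set x | h x <= i%:R * d] x).
    by apply: bmeasB => //; exact: bmeasM.
  rewrite cintZ; last exact: bmeas_sum.
  rewrite cint_sum//; congr (_ * _); apply: eq_bigr => i _.
  by rewrite cintB//; exact: bmeasM.
rewrite mulrCA ler_pM2l// mulr_sumr; apply: ler_sum => i _.
rewrite big_split /= sumr_const card_ord sumrN mulrBr; apply: lerB => //.
by rewrite -ler_pdivlMl.
Qed.

End LayerCake.

(** * Closed sets defined by Lipschitz functions *)

Section Lipschitz.
Variable R : realType.

Lemma lip1_coord n (i : 'I_n) : lip1 (fun x : 'rV[R]_n => x ord0 i).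
Proof. by move=> x y; rewrite (bigD1 i)//= lerDl sumr_ge0. Qed.

Lemma lip1_cst n (c : R) : lip1 (fun _ : 'rV[R]_n => c).
Proof. by move=> x y; rewrite subrr normr0 sumr_ge0. Qed.

Lemma lip1_subset n (J : {set 'I_n}) (c : R) :
  lip1 (fun x : 'rV[R]_n => \sum_(j in J) x ord0 j - c).
Proof.
move=> x y; rewrite opprB addrA subrK -sumrB; apply: (le_trans (ler_norm_sum _ _ _)).
by rewrite big_mkcond /=; apply: ler_sum => i _; case: ifP.
Qed.

Lemma lip1_addr n (f : 'rV[R]_n -> R) c : lip1 f -> lip1 (fun x => f x + c).
Proof. by move=> lf x y; rewrite opprD addrACA subrr addr0. Qed.

Lemma closed_le_lip1 n (f g : 'rV[R]_n -> R) : lip1 f -> lip1 g ->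
  closed [set x | f x <= g x].
Proof.
(* The difference has constant 2; halving brings it back to [lip1] without changing its sign. *)
move=> lf lg; have lfg : lip1 (fun x => 2^-1 * (f x - g x)).
  move=> x y; rewrite -mulrBr normrM ger0_norm ?invr_ge0//.
  rewrite ler_pdivrMl// mulr_natl mulr2n.
  rewrite (_ : _ - _ = (f x - f y) - (g x - g y)); last by lra.
  by apply: (le_trans (ler_normB _ _)); apply: lerD.
rewrite (_ : mkset _ = (fun x => 2^-1 * (f x - g x)) @^-1` [set t | t <= 0]).
  by apply: closed_comp => [x _|]; [exact: continuous_lip1|exact: closed_le].
by apply/seteqP; split=> x /=; rewrite pmulr_rle0 ?invr_gt0// subr_le0.
Qed.

Lemma closed_cube n : closed (@cube R n).
Proof.
rewrite (_ : cube n = \bigcap_(i in [set: 'I_n]) ([set x | 0 <= x ord0 i] `&`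
    [set x | x ord0 i <= 1])).
  apply: closed_bigI => i _; apply: closedI; apply: closed_le_lip1;
    by [exact: lip1_coord|exact: lip1_cst].
apply/seteqP; split=> x h i; first by move=> _; have /andP[] := h i.
by have [] := h i Logic.I => /= -> ->.
Qed.

End Lipschitz.

(** * SJA and the regions U_J *)

Section SJA.
Variables (R : realType) (m : nat) (P : nat -> R).
Hypothesis P0 : P 0%N = 0.
Implicit Types (x : 'rV[R]_m) (J L : {set 'I_m}).

Lemma sja_utility (y x : 'rV[R]_m) : utility (sja_mech m P) y x =
  \sum_(j in sja_bundle m P y) x ord0 j - P #|sja_bundle m P y|.
Proof.
rewrite /utility /=; congr (_ - _); rewrite [RHS]big_mkcond /=.
by apply: eq_bigr => i _; rewrite mxE; case: (_ \in _); rewrite ?mul1r ?mul0r.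
Qed.

Lemma sja_bundle_max x L : \sum_(j in L) x ord0 j - P #|L| <=
  utility (sja_mech m P) x x.
Proof.
rewrite sja_utility /sja_bundle.
by case: arg_maxP => //= J _ h; exact: h.
Qed.

Lemma sja_feasible : feasible (sja_mech m P).
Proof. by move=> x _ i; rewrite mxE; case: (_ \in _); rewrite ?lexx ?ler01. Qed.

Lemma sja_IC : IC (sja_mech m P).
Proof. by move=> x y _ _; rewrite sja_utility; exact: sja_bundle_max. Qed.

Lemma sja_IR : IR (sja_mech m P).
Proof.
move=> x _; apply: le_trans (sja_bundle_max x finset.set0).
by rewrite big_set0 cards0 P0 subrr.
Qed.

Lemma norm_price0 : norm_price m P 0 = 0.
Proof. by rewrite /norm_price /= P0. Qed.

Lemma norm_price_le r : norm_price m P r <= P r.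
Proof. by rewrite /norm_price; case: ifP => // /andP[_]. Qed.

(* Normalising the prices does not change the buyer's indirect utility: a
   bundle whose price was lowered to P m is dominated by the grand bundle. *)
Lemma sja_norm_max x L : cube m x ->
  \sum_(j in L) x ord0 j - norm_price m P #|L| <= utility (sja_mech m P) x x.
Proof.
move=> cx; rewrite /norm_price; case: ifP => _; last exact: sja_bundle_max.
apply: le_trans (sja_bundle_max x [set: 'I_m]%SET).
rewrite cardsT card_ord lerD2r big_mkcond [leRHS]big_mkcond /=.
apply: ler_sum => j _; rewrite finset.in_setT; case: ifP => // _.
by case/andP: (cx j).
Qed.

(** The mechanism uses the original prices and U_J the normalised ones. Normalised prices are lower,
    and [sja_norm_max] shows that the buyer gains nothing from this. *)
Lemma utility_U_set x J : U_set m P J x ->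
  utility (sja_mech m P) x x = \sum_(j in J) x ord0 j - norm_price m P #|J|.
Proof.
move=> [cx UJ]; apply/eqP; rewrite eq_le sja_norm_max// andbT sja_utility.
apply: le_trans (UJ (sja_bundle m P x)).
by apply: lerB => //; exact: norm_price_le.
Qed.

(** Written with the original prices exactly as in [sja_prob], so that the condition fixing P m
    gives its volume. *)
Definition unsold : set 'rV[R]_m := cube m `&`
  [set x | forall J, (0 < #|J|)%N -> \sum_(j in J) x ord0 j < P #|J|].

Lemma unsold_utility x : unsold x -> utility (sja_mech m P) x x = 0.
Proof.
move=> [cx h]; apply/eqP; rewrite eq_le sja_IR// andbT sja_utility.
have [/eqP|J0] := posnP #|sja_bundle m P x|; last by rewrite subr_le0 ltW// h.
by rewrite cards_eq0 => /eqP ->; rewrite big_set0 cards0 P0 subrr.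
Qed.

(** A nonempty bundle is required to apply the deficiency hypothesis. If only the empty bundle is
    optimal for normalised prices, a nonempty bundle of value at least its price would tie with
    it. *)
Lemma sold_U_set x : cube m x -> ~ unsold x ->
  exists J, (0 < #|J|)%N /\ U_set m P J x.
Proof.
move=> cx nE; apply: contrapT => noJ; apply: nE; split=> // J J0.
pose F L := \sum_(j in L) x ord0 j - norm_price m P #|L|.
have [K _ Kmax] : extremum_spec >=%O predT F (Order.arg_max (finset.set0 : {set 'I_m}) predT F).
  exact: arg_maxP.
have UK : U_set m P K x by split=> // L; exact: Kmax.
have K0 : K = finset.set0.
  by apply/eqP; rewrite -cards_eq0 -leqn0 leqNgt; apply/negP => K0; apply: noJ; exists K.
rewrite ltNge; apply/negP => PJ; apply: noJ; exists J; split=> //; split=> // L.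
apply: le_trans (Kmax L isT) _; rewrite K0 /F big_set0 cards0 norm_price0 subr0 subr_ge0.
exact: le_trans (norm_price_le _) PJ.
Qed.

Lemma sum_setc x L j t : \sum_(i in L) setc x j t ord0 i =
  \sum_(i in L) x ord0 i + (j \in L)%:R * (t - x ord0 j).
Proof.
case: (boolP (j \in L)) => jL.
  rewrite !(bigD1 j jL) /= setc_at mul1r.
  rewrite (eq_bigr (fun i => x ord0 i)); first by lra.
  by move=> i /andP[_ ij]; rewrite setc_other.
rewrite mul0r addr0; apply: eq_bigr => i iL; rewrite setc_other//.
by apply: contraNneq jL => <-.
Qed.

(** Raising x_j gives J the whole gain 1 - x_j and any rival at most that. *)
Lemma U_set_setc x J j : j \in J -> U_set m P J x -> U_set m P J (setc x j 1).
Proof.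
move=> jJ [cx UJ]; split; first by apply: cube_setc => //; rewrite ler01 lexx.
move=> L; rewrite !sum_setc jJ; have := UJ L; have /andP[_ x1] := cx j.
by case: (j \in L); rewrite ?mul1r ?mul0r; lra.
Qed.

Lemma closed_U_set J : closed (U_set m P J).
Proof.
rewrite (_ : U_set m P J = cube m `&` \bigcap_(L in [set: {set 'I_m}])
  [set x | \sum_(j in L) x ord0 j - norm_price m P #|L|
       <= \sum_(j in J) x ord0 j - norm_price m P #|J| ]).
  apply: closedI; first exact: closed_cube.
  by apply: closed_bigI => L _; apply: closed_le_lip1; exact: lip1_subset.
by apply/seteqP; split=> x [cx h]; split=> // L; [move=> _; exact: h|exact: (h L Logic.I)].
Qed.

Lemma rset_U_set J : rset (U_set m P J).
Proof.
rewrite (_ : U_set m P J = cube m `&` [set x | forall L : {set 'I_m},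
       \sum_(j in L) x ord0 j - norm_price m P #|L|
       <= \sum_(j in J) x ord0 j - norm_price m P #|J| ])//.
apply: rsetI; first exact: rset_cube.
by apply: rset_forall => L; apply: rset_le; apply: rmeas_lip1; exact: lip1_subset.
Qed.

Lemma rset_unsold : rset unsold.
Proof.
apply: rsetI; first exact: rset_cube.
apply: rset_forall => J; apply: rset_imply; apply: rset_lt => //.
by rewrite (_ : (fun x => _) = (fun x : 'rV[R]_m => \sum_(j in J) x ord0 j - 0));
  [apply: rmeas_lip1; exact: lip1_subset|apply/funext => x; rewrite subr0].
Qed.

(* In the coordinates y = (m+1)(1 - x_J), the slices of U_J lie in the SIM-body. *)
Lemma SIM_body_slice J x (y : 'rV[R]_#|J|) : U_set m P J x ->
  (forall b : 'I_#|J|, y ord0 b = (m%:R + 1) * (1 - x ord0 (enum_val b))) ->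
  SIM_body #|J| (lambda m P) y.
Proof.
move=> [cx UJ] yE; have m0 : 0 < m%:R + 1 :> R by rewrite ltr_wpDl.
split=> [b|S].
  by rewrite yE mulr_ge0 ?(ltW m0)// subr_ge0; case/andP: (cx (enum_val b)).
have muE r : mu m P r = (m%:R + 1) * (r%:R - norm_price m P r).
  by case: r => //=; rewrite norm_price0 subrr mulr0.
have cS : (#|S| <= #|J|)%N by rewrite -[X in (_ <= X)%N]card_ord; exact: max_card.
have -> : \sum_((#|J| - #|S|).+1 <= j < #|J|.+1) lambda m P j =
    mu m P #|J| - mu m P (#|J| - #|S|).
  rewrite big_add1 /= -telescope_sumr ?leq_subr//.
pose T : {set 'I_m} := [set enum_val b | b in S]%SET.
have TJ : T \subset J by apply/fintype.subsetP => i /imsetP[b _ ->]; exact: enum_valP.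
have cT : #|T| = #|S| by rewrite card_imset//; exact: enum_val_inj.
(* Comparing J with the bundle that drops the items T selected by S yields precisely the SIM
   constraint for S, whose right-hand side has telescoped to a difference of [mu]. *)
have := UJ (J :\: T)%SET; rewrite cardsD (finset.setIidPr TJ) cT.
have -> : \sum_(j in J) x ord0 j = \sum_(j in (J :\: T)%SET) x ord0 j + \sum_(b in S) x ord0 (enum_val b).
  rewrite (big_setID T) /= (finset.setIidPr TJ) addrC; congr (_ + _).
  by rewrite big_imset//= => b b' _ _; exact: enum_val_inj.
have -> : \sum_(b in S) y ord0 b = (m%:R + 1) * (#|S|%:R - \sum_(b in S) x ord0 (enum_val b)).
  by rewrite (eq_bigr _ (fun b _ => yE b)) -mulr_sumr sumrB sumr_const.
rewrite !muE -mulrBr ler_pM2l// natrB//; lra.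
Qed.

End SJA.

(** * Comparison of SJA with an arbitrary mechanism *)

Section Optimality.
Variables (R : realType) (m : nat) (P : nat -> R).
Hypothesis P0 : P 0%N = 0.
Hypothesis noSIM : forall J : {set 'I_m}, (0 < #|J|)%N -> U_set m P J !=set0 ->
     ~ (exists A : set 'rV[R]_#|J|,
          body A /\ A `<=` SIM_body #|J| (lambda m P) /\
          (0 < deficiency 1 A)%E).

Let c : R := m%:R + 1.

Let c_gt0 : 0 < c. Proof. by rewrite ltr_wpDl. Qed.

Let bmeas_ind_setc (A : set 'rV[R]_m) j : rset A ->
  bmeas (fun x => \1_A (setc x j 1) : R).
Proof. by move=> mA; apply: (bmeas_setc j (bmeas_indic mA)); rewrite ler01 lexx. Qed.

(** B will be a sublevel set of u - v, which inside U_J is stable under raising a coordinate of J to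
    1. *)
Lemma U_set_deficiency (B : set 'rV[R]_m) (J : {set 'I_m}) :
  closed B -> rset B -> (0 < #|J|)%N ->
  (forall x j, j \in J -> U_set m P J x -> B x -> B (setc x j 1)) ->
  cint (\1_(U_set m P J `&` B)) <=
    c^-1 * \sum_(j in J) cint (fun x => \1_(U_set m P J `&` B) (setc x j 1)).
Proof.
move=> clB mB J0 B1; have mA : rset (U_set m P J `&` B).
  by apply: rsetI => //; exact: rset_U_set.
have [UJ0|UJ0] := pselect (U_set m P J !=set0); last first.
  rewrite (@eq_cint _ _ _ (fun=> 0)) ?cint_cst; last first.
    by move=> x _; rewrite indicE memNset// => -[Ux _]; apply: UJ0; exists x.
  rewrite mulr_ge0 ?invr_ge0 ?(ltW c_gt0)// sumr_ge0// => j _.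
  by apply: cint_ge0 => x; rewrite indicE.
have := @deficiency_le R m c J (U_set m P J `&` B) J0 c_gt0.
rewrite cintZ; last by apply: bmeas_sum => j; exact: bmeas_ind_setc.
rewrite cint_sum; last by move=> j; exact: bmeas_ind_setc.
apply=> //.
- by move=> x [[]].
- by apply: closedI => //; exact: closed_U_set.
- by move=> x j jJ [Ux Bx]; split; [exact: U_set_setc|exact: B1].
move=> D bD DA dD; apply: (noSIM J0 UJ0); exists D; split=> //; split=> // y /DA[x [Ux _] yx].
exact: (SIM_body_slice P0 Ux).
Qed.

Lemma tie_null (J L : {set 'I_m}) b : J != L ->
  cint (\1_[set x : 'rV[R]_m | \sum_i ((i \in J)%:R - (i \in L)%:R) * x ord0 i = b]) = 0.
Proof.
move=> JL; rewrite /cint icube_hyperplane//.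
apply: contrapT => no; move/eqP: JL; apply; apply/setP => i.
apply/eqP/negPn/negP => iJL; apply: no; exists i.
by rewrite subr_eq0 eqr_nat; move: iJL; case: (i \in J); case: (i \in L).
Qed.

(** On a common point both bundles have the same value; since j lies in both, the overwritten
    coordinate cancels and a linear equation in x itself remains. *)
Lemma U_set_tie (J L : {set 'I_m}) j x : j \in J -> j \in L ->
  U_set m P J (setc x j 1) -> U_set m P L (setc x j 1) ->
  \sum_i ((i \in J)%:R - (i \in L)%:R) * x ord0 i =
    norm_price m P #|J| - norm_price m P #|L|.
Proof.
move=> jJ jL [_ /(_ L)] UJ [_ /(_ J)] UL.
have : \sum_(i in J) setc x j 1 ord0 i - norm_price m P #|J| =
    \sum_(i in L) setc x j 1 ord0 i - norm_price m P #|L|.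
  by apply/eqP; rewrite eq_le UL UJ.
rewrite !sum_setc jJ jL; move: (norm_price _ _ _) (norm_price _ _ _) => p q.
have E (K : {set 'I_m}) : \sum_i (i \in K)%:R * x ord0 i = \sum_(i in K) x ord0 i.
  rewrite [RHS]big_mkcond; apply: eq_bigr => i _.
  by case: (_ \in _); rewrite ?mul1r ?mul0r.
have -> : \sum_i ((i \in J)%:R - (i \in L)%:R) * x ord0 i =
    \sum_(i in J) x ord0 i - \sum_(i in L) x ord0 i.
  by rewrite -!E -sumrB; apply: eq_bigr => i _; rewrite mulrBl.
lra.
Qed.

(* Two different regions U_J and U_L meet the face x_j = 1 in a null set, so
   their parts on that face may be added up. *)
Lemma U_set_face_le (B : set 'rV[R]_m) j : rset B ->
  \sum_(J : {set 'I_m} | j \in J)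
      cint (fun x => \1_(U_set m P J `&` B) (setc x j 1)) <=
  cint (fun x => \1_B (setc x j 1)).
Proof.
move=> mB.
have mA J : rset (U_set m P J `&` B) by apply: rsetI => //; exact: rset_U_set.
pose T (J L : {set 'I_m}) := [set x : 'rV[R]_m |
  \sum_i ((i \in J)%:R - (i \in L)%:R) * x ord0 i =
  norm_price m P #|J| - norm_price m P #|L|].
have nT J L : bmeas (\1_(T J L) : 'rV[R]_m -> R).
  by apply: bmeas_indic; exact: rset_hyperplane.
(* S counts ties and integrates to 0, so adding it turns an almost everywhere inequality into a
   pointwise one. *)
pose S x : R := \sum_(J : {set 'I_m}) \sum_(L | L != J) \1_(T J L) x.
have nS : bmeas S by apply: bmeas_sum => J; exact: bmeas_sum.
have S0 : cint S = 0.
  rewrite cint_sum; last by move=> J; exact: bmeas_sum.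
  rewrite big1// => J _; rewrite cint_sum// big1// => L LJ.
  by apply: tie_null; rewrite eq_sym.
rewrite -cint_sum; last by move=> J; exact: bmeas_ind_setc.
have -> : cint (fun x => \1_B (setc x j 1)) = cint (fun x => \1_B (setc x j 1) + S x).
  by rewrite cintD ?S0 ?addr0//; exact: bmeas_ind_setc.
apply: le_cint.
- by apply: bmeas_sum => J; exact: bmeas_ind_setc.
- by apply: bmeasD => //; exact: bmeas_ind_setc.
move=> x _.
have Sge0 (J : {set 'I_m}) : 0 <= \sum_(L : {set 'I_m} | L != J) \1_(T J L) x :> R.
  by apply: sumr_ge0 => L _; rewrite indicE.
have [[J [jJ [UJ Bx]]]|no] := pselect (exists J : {set 'I_m}, j \in J /\
    U_set m P J (setc x j 1) /\ B (setc x j 1)).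
  rewrite (bigD1 J)//= !indicE !mem_set//= lerD2l.
  apply: (@le_trans _ _ (\sum_(L : {set 'I_m} | L != J) \1_(T J L) x)); last first.
    by rewrite /S [leRHS](bigD1 J)//= lerDl sumr_ge0.
  rewrite big_mkcond [leRHS]big_mkcond /=; apply: ler_sum => L _.
  rewrite [in leRHS]indicE; have [->|LJ] := eqVneq L J; first by rewrite andbF.
  rewrite andbT; case: ifP => // jL; rewrite indicE ler_nat.
  case: (boolP (_ \in _)) => //= /set_mem [UL _].
  by rewrite mem_set//; exact: U_set_tie UJ UL.
rewrite big1 ?addr_ge0 ?sumr_ge0 ?indicE// => J jJ.
by rewrite indicE memNset// => -[UJ Bx]; apply: no; exists J.
Qed.

(** In the cube the regions of nonempty bundles cover everything sold, and overlaps only enlarge the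
    sum; after exchanging the sums, [U_set_face_le] handles each face. *)
Lemma level_le (B : set 'rV[R]_m) : closed B -> rset B ->
  (forall (J : {set 'I_m}) x j, j \in J -> U_set m P J x -> B x -> B (setc x j 1)) ->
  cint (fun x => (1 - \1_(unsold P) x) * \1_B x) <=
    c^-1 * \sum_(j < m) cint (fun x => \1_B (setc x j 1)).
Proof.
move=> clB mB B1.
have mA J : rset (U_set m P J `&` B) by apply: rsetI => //; exact: rset_U_set.
apply: (@le_trans _ _ (cint (fun x => \sum_(J : {set 'I_m} | (0 < #|J|)%N)
    \1_(U_set m P J `&` B) x))).
  apply: le_cint.
  - apply: bmeasM; last exact: bmeas_indic.
    by apply: bmeasB; [exact: bmeas_cst|apply: bmeas_indic; exact: rset_unsold].
  - by apply: bmeas_sum => J; exact: bmeas_indic.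
  move=> x cx; have s0 : 0 <= \sum_(J : {set 'I_m} | (0 < #|J|)%N)
      \1_(U_set m P J `&` B) x :> R by apply: sumr_ge0 => J _; rewrite indicE.
  have [xE|xE] := pselect (unsold P x).
    by rewrite [X in 1 - X]indicE mem_set// subrr mul0r.
  have [xB|xB] := pselect (B x); last by rewrite [X in _ * X]indicE memNset// mulr0.
  have [J [J0 UJ]] := sold_U_set P0 cx xE.
  rewrite !indicE memNset// mem_set// subr0 mulr1 (bigD1 J)//= indicE mem_set//=.
  by rewrite lerDl sumr_ge0// => L _; rewrite indicE.
rewrite cint_sum; last by move=> J; exact: bmeas_indic.
apply: (@le_trans _ _ (\sum_(J : {set 'I_m} | (0 < #|J|)%N) c^-1 *
    \sum_(j in J) cint (fun x => \1_(U_set m P J `&` B) (setc x j 1)))).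
  by apply: ler_sum => J J0; apply: U_set_deficiency => // x j; exact: B1.
rewrite -mulr_sumr ler_wpM2l ?invr_ge0 ?(ltW c_gt0)//.
rewrite (exchange_big_dep xpredT)//=; apply: ler_sum => j _.
apply: le_trans (U_set_face_le j mB); rewrite le_eqVlt; apply/orP; left; apply/eqP.
apply: eq_bigl => J; case: (boolP (j \in J)) => jJ; rewrite ?andbF// andbT.
by apply/card_gt0P; exists j.
Qed.

Hypothesis PE : cint (\1_(@unsold R m P)) = c^-1.

Lemma Phi_le_sja (u : 'rV[R]_m -> R) : utilfun u ->
  Phi u <= Phi (indirect (sja_mech m P)).
Proof.
move=> uu; have uus := utilfun_indirect (@sja_feasible R m P) (@sja_IC R m P) (@sja_IR R m P P0).
have usE x : cube m x -> indirect (sja_mech m P) x = utility (sja_mech m P) x x.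
  by move=> cx; rewrite /indirect clamp_id.
move: (indirect _) usE uus => us usE uus.
have [lu [C uC] _ _] := uu; have [lus [G usG] _ _] := uus.
have nu := utilfun_nice uu; have nus := utilfun_nice uus.
(* G bounds the utility of SJA, which makes h nonnegative. *)
pose h x := u x - us x + G.
have nh : bmeas h by apply: bmeasD; [exact: bmeasB|exact: bmeas_cst].
pose w (x : 'rV[R]_m) : R := 1 - \1_(unsold P) x.
have nE : bmeas (\1_(@unsold R m P) : 'rV[R]_m -> R).
  by apply: bmeas_indic; exact: rset_unsold.
have nw : bmeas w by apply: bmeasB => //; exact: bmeas_cst.
have cw : cint w = 1 - c^-1 by rewrite cintB ?cint_cst ?PE//; exact: bmeas_cst.
(* Stated as a comparison of two [lip1] functions, for which closedness and measurability of the set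
   are available. *)
have hle t : [set x | h x <= t] = [set x | u x <= us x + (t - G)].
  by apply/seteqP; split=> x /=; rewrite /h; lra.
have lc : \sum_(j < m) cint (fun x => h (setc x j 1)) <= c * cint (fun x => w x * h x).
  apply: (@layer_cake _ _ _ _ _ (C + G)) => //.
  - move=> x _; have /andP[? ?] := uC x; have /andP[? ?] := usG x.
    by rewrite /h; apply/andP; split; lra.
  - by move=> x _; rewrite /w indicE; case: (_ \in _); rewrite ?subrr ?subr0 ?lexx ?ler01.
  - by rewrite cw mulrBr mulr1 divff ?gt_eqF// /c addrK.
  move=> t; rewrite hle; apply: level_le.
  - by apply: closed_le_lip1 => //; exact: lip1_addr.
  - by apply: rset_le; apply: rmeas_lip1 => //; exact: lip1_addr.
  move=> J x j jJ UJ /=.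
  have cx : cube m x by case: UJ.
  have UJ1 := U_set_setc jJ UJ.
  have c1 : cube m (setc x j 1) by case: UJ1.
  (* On U_J raising x_j to 1 increases the SJA utility by the full 1 - x_j and u by at most that. *)
  rewrite !usE// (utility_U_set UJ) (utility_U_set UJ1) sum_setc jJ mul1r.
  have := lu (setc x j 1) x; rewrite (bigD1 j)//= big1 ?addr0; last first.
    by move=> i ij; rewrite setc_other// subrr normr0.
  rewrite setc_at (ger0_norm (_ : 0 <= 1 - x ord0 j)); last first.
    by rewrite subr_ge0; case/andP: (cx j).
  by rewrite ler_norml => /andP[_]; lra.
(* On the unsold set, of volume 1/c, h is at least G. *)
have wh : cint (fun x => w x * h x) <= cint h - G * c^-1.
  rewrite -PE -(cintZ G nE) -cintB//; last exact: bmeasZ.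
  apply: le_cint; [exact: bmeasM|by apply: bmeasB => //; exact: bmeasZ|move=> x cx].
  rewrite /w indicE; case: (boolP (x \in _)) => [/set_mem xE|_].
    rewrite subrr mul0r mulr1 /h usE// (unsold_utility P0 xE).
    by have /andP[] := uC x; lra.
  by rewrite subr0 mul1r mulr0 subr0.
have hE : cint h = cint u - cint us + G.
  by rewrite cintD ?cintB ?cint_cst//; [exact: bmeasB|exact: bmeas_cst].
have i01 : 0 <= (1 : R) <= 1 by rewrite ler01 lexx.
have FE j : cint (fun x => h (setc x j 1)) =
    cint (fun x => u (setc x j 1)) - cint (fun x => us (setc x j 1)) + G.
  have n1 := bmeas_setc j nu i01; have n2 := bmeas_setc j nus i01.
  by rewrite (cintD (bmeasB n1 n2) (@bmeas_cst _ _ G)) (cintB n1 n2) cint_cst.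
have cwh : c * cint (fun x => w x * h x) <= c * (cint u - cint us + G) - G.
  apply: (@le_trans _ _ (c * (cint h - G * c^-1))); first by rewrite ler_pM2l.
  by rewrite hE mulrBr [G * _]mulrC mulVKf// gt_eqF.
have := le_trans lc cwh; under eq_bigr do rewrite FE.
rewrite !big_split /= sumrN sumr_const card_ord -[G *+ m]mulr_natl /Phi -/c.
rewrite (_ : c * (cint u - cint us + G) = c * cint u - c * cint us + m%:R * G + G); first lra.
by rewrite /c; ring.
Qed.

End Optimality.

Lemma cint_unsold (R : realType) (m : nat) (P : nat -> R) : sja_prices m P ->
  cint (\1_(@unsold R m P)) = (m%:R + 1)^-1.
Proof.
move=> [_ hP]; apply: EFin_inj; rewrite -icubeE; last first.
  by apply: bmeas_indic; exact: rset_unsold.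
rewrite -iint_indic_cube; last by move=> x [].
(* For m = 0 no price condition exists; the unsold set is then the whole cube, of volume 1. *)
case: m hP => [|m] hP.
  rewrite iint_indic_cube; last by move=> x [].
  rewrite add0r invr1 -(icube1 R 0); apply: eq_icube => x cx.
  by rewrite indicE mem_set//; split=> // J; rewrite leqNgt ltnS (leq_trans (max_card _))// card_ord.
have [e _] := hP m.+1 (leqnn _).
rewrite -[LHS]/(sja_prob m.+1 P) e; congr EFin.
by field; rewrite gt_eqF// ltr_wpDl// addr_ge0.
Qed.

Unset Implicit Arguments.

Theorem theorem4 (R : realType) (m : nat) (P : nat -> R) :
  sja_prices m P ->
  (forall J : {set 'I_m}, (0 < #|J|)%N -> U_set m P J !=set0 ->
     ~ (exists A : set 'rV[R]_#|J|,
          body A /\ A `<=` SIM_body #|J| (lambda m P) /\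
          (0 < deficiency 1 A)%E)) ->
  revenue (sja_mech m P) = opt_revenue R m.
Proof.
move=> hP noSIM; have P0 : P 0%N = 0 by case: hP.
have fe := @sja_feasible R m P; have ic := @sja_IC R m P; have ir := @sja_IR R m P P0.
apply/eqP; rewrite eq_le; apply/andP; split.
  by apply: ereal_sup_ubound; exists (sja_mech m P).
apply: ge_ereal_sup => _ [M [feM [icM irM]] <-].
rewrite !revenueE// lee_fin; apply: Phi_le_sja => //.
  exact: cint_unsold.
exact: utilfun_indirect.
Qed.
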